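(* Let $(\alpha_n)_{n\in\mathbb N}$ and $(\beta_n)_{n\in\mathbb N}$ be sequences in $(0,1)$ such that $\sup_{n\in\mathbb N}\alpha_n<1$ and $\sup_{n\in\mathbb N}\beta_n<1$, let $(\lambda_n)_{n\in\mathbb N}$ be a sequence in $(0,1]$ such that $\inf_{n\in\mathbb N}\lambda_n>0$, and set $D=\{0,1\}^m\smallsetminus\{\mathbf 0\}$. Let $\boldsymbol x_0$, $(\boldsymbol a_n)_{n\in\mathbb N}$, and $(\boldsymbol b_n)_{n\in\mathbb N}$ be $\mathbf H$-valued random variables, and let $(\boldsymbol\varepsilon_n)_{n\in\mathbb N}$ be identically distributed $D$-valued random variables. For every $n\in\mathbb N$, let $\mathbf R_n\colon\mathbf H\to\mathbf H$ be $\beta_n$-averaged and let $\mathbf T_n\colon\mathbf H\to\mathbf H\colon\mathbf x\mapsto(T_{i,n}\mathbf x)_{1\le i\le m}$ be $\alpha_n$-averaged, where, for every $i\in\{1,\dots,m\}$, $T_{i,n}\colon\mathbf H\to H_i$. Iterate, for $n=0,1,\dots$, $$\boldsymbol y_n=\mathbf R_n\boldsymbol x_n+\boldsymbol b_n,\qquad\text{and, for } i=1,\dots,m,\quad x_{i,n+1}=x_{i,n}+\varepsilon_{i,n}\lambda_n\big(T_{i,n}\boldsymbol y_n+a_{i,n}-x_{i,n}\big),$$ and set $(\forall n\in\mathbb N)$ $\mathcal E_n=\sigma(\boldsymbol\varepsilon_n)$. In addition, assume that the following hold: (i) $\mathbf F=\bigcap_{n\in\mathbb N}\operatorname{Fix}(\mathbf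 T_n\circ\mathbf R_n)\neq\varnothing$. (ii) $\sum_{n\in\mathbb N}\sqrt{\mathsf E(\|\boldsymbol a_n\|^2\mid\mathcal X_n)}<+\infty$ and $\sum_{n\in\mathbb N}\sqrt{\mathsf E(\|\boldsymbol b_n\|^2\mid\mathcal X_n)}<+\infty$. (iii) For every $n\in\mathbb N$, $\mathcal E_n$ and $\mathcal X_n$ are independent. (iv) $(\forall i\in\{1,\dots,m\})$ $p_i=\mathsf P[\varepsilon_{i,0}=1]>0$. Then $$\big[(\forall\mathbf z\in\mathbf F)\ \ \mathbf T_n(\mathbf R_n\boldsymbol x_n)-\mathbf R_n\boldsymbol x_n+\mathbf R_n\mathbf z\to\mathbf z\big]\quad\mathsf P\text{-a.s.}$$ and $$\big[(\forall\mathbf z\in\mathbf F)\ \ \boldsymbol x_n-\mathbf R_n\boldsymbol x_n+\mathbf R_n\mathbf z\to\mathbf z\big]\quad\mathsf P\text{-a.s.}$$ Furthermore, suppose that: (v) $\mathfrak W(\boldsymbol x_n)_{n\in\mathbb N}\subset\mathbf F$ $\mathsf P$-a.s. Then $(\boldsymbol x_n)_{n\in\mathbb N}$ converges weakly $\mathsf P$-a.s. to an $\mathbf F$-valued random variable $\boldsymbol x$. If, in addition, (vi) $\mathfrak S(\boldsymbol x_n)_{n\in\mathbb N}\neq\varnothing$ $\mathsf P$-a.s., then $(\boldsymbol x_n)_{n\in\mathbb N}$ converges strongly $\mathsf P$-a.s. to $\boldsymbol x$.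
   Context: $H_1,\dots,H_m$ are separable real Hilbert spaces and $\mathbf H=H_1\oplus\cdots\oplus H_m$ is their direct Hilbert sum; all norms are denoted $\|\cdot\|$. $(\Omega,\mathcal F,\mathsf P)$ is the underlying probability space; random variables with values in a Hilbert space are Borel-measurable maps from $\Omega$. For $\boldsymbol x_n=(x_{1,n},\dots,x_{m,n})$, $\mathcal X_n=\sigma(\boldsymbol x_0,\dots,\boldsymbol x_n)$. Components: $\boldsymbol a_n=(a_{i,n})_{1\le i\le m}$, $\boldsymbol\varepsilon_n=(\varepsilon_{i,n})_{1\le i\le m}$. $\operatorname{Fix}$ denotes the fixed point set. An operator is nonexpansive if it is $1$-Lipschitz; for $\alpha\in(0,1)$, a nonexpansive $\mathbf T\colon\mathbf H\to\mathbf H$ is $\alpha$-averaged if $\mathbf T=(1-\alpha)\mathrm{Id}+\alpha\mathbf Q$ for some nonexpansive $\mathbf Q\colon\mathbf H\to\mathbf H$. $\mathfrak S(\cdot)$ and $\mathfrak W(\cdot)$ denote the sets of strong and weak sequential cluster points of a sequence (taken pointwise in $\omega$ for random sequences); $\to$ denotes strong convergence. Equalities and inequalities involving random variables are understood to hold $\mathsf P$-almost surely. *)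

(* Defs.v *)
From HB Require Import structures.
From mathcomp Require Import all_boot all_order all_algebra.
From mathcomp Require Import sesquilinear.
From mathcomp Require Import all_classical all_reals all_analysis measurable_realfun.
From mathcomp Require Import ring lra.

Set Implicit Arguments.
Unset Strict Implicit.
Unset Printing Implicit Defensive.

Import Order.TTheory GRing.Theory Num.Theory.
Import numFieldNormedType.Exports.

Local Open Scope classical_set_scope.
Local Open Scope ring_scope.

HB.mixin Record CompleteNormedModule_isHilbert (R : realType) V
    & CompleteNormedModule R V := {
  inner : {dot V for (@idfun R)} ;
  inner_normE : forall x : V, inner x x = `|x| ^+ 2
}.

#[short(type="hilbertType")]
HB.structure Definition Hilbert (R : realType) :=
  {V of CompleteNormedModule R V & CompleteNormedModule_isHilbert R V}.

Section hilbert_theory.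
Context {R : realType} {V : hilbertType R}.
Implicit Types x y : V.

Lemma innerC x y : inner x y = inner y x.
Proof. by rewrite hermC/= mul1r. Qed.

End hilbert_theory.

(** The direct Hilbert sum of a finite family. *)
Section hilbert_sum.
Context {R : realType} {I : finType}.

Definition hsum (H : I -> hilbertType R) : Type := forall i, H i.

Variable H : I -> hilbertType R.
Implicit Types x y z : hsum H.

HB.instance Definition _ := gen_eqMixin (hsum H).
HB.instance Definition _ := gen_choiceMixin (hsum H).

Definition hsum_zero : hsum H := fun i => 0.
Definition hsum_opp x : hsum H := fun i => - x i.
Definition hsum_add x y : hsum H := fun i => x i + y i.
Definition hsum_scale (c : R) x : hsum H := fun i => c *: x i.

Fact hsum_addA : associative hsum_add.
Proof. by move=> x y z; apply: functional_extensionality_dep => i; exact: addrA. Qed.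

Fact hsum_addC : commutative hsum_add.
Proof. by move=> x y; apply: functional_extensionality_dep => i; exact: addrC. Qed.

Fact hsum_add0 : left_id hsum_zero hsum_add.
Proof. by move=> x; apply: functional_extensionality_dep => i; exact: add0r. Qed.

Fact hsum_addN : left_inverse hsum_zero hsum_opp hsum_add.
Proof. by move=> x; apply: functional_extensionality_dep => i; exact: addNr. Qed.

HB.instance Definition _ := GRing.isZmodule.Build (hsum H)
  hsum_addA hsum_addC hsum_add0 hsum_addN.

Fact hsum_scaleA a b x : hsum_scale a (hsum_scale b x) = hsum_scale (a * b) x.
Proof. by apply: functional_extensionality_dep => i; exact: scalerA. Qed.

Fact hsum_scale1 : left_id 1 hsum_scale.
Proof. by move=> x; apply: functional_extensionality_dep => i; exact: scale1r. Qed.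

Fact hsum_scaleDr : right_distributive hsum_scale +%R.
Proof. by move=> c x y; apply: functional_extensionality_dep => i; exact: scalerDr. Qed.

Fact hsum_scaleDl x : {morph hsum_scale^~ x : a b / a + b}.
Proof. by move=> a b; apply: functional_extensionality_dep => i; exact: scalerDl. Qed.

HB.instance Definition _ := GRing.Zmodule_isLmodule.Build R (hsum H)
  hsum_scaleA hsum_scale1 hsum_scaleDr hsum_scaleDl.

Definition hsum_inner x y : R := \sum_i inner (x i) (y i).

Definition hsum_norm x : R := Num.sqrt (\sum_i `|x i| ^+ 2).

Fact hsum_normsq x : hsum_norm x ^+ 2 = \sum_i `|x i| ^+ 2.
Proof. by rewrite sqr_sqrtr// sumr_ge0// => i _; exact: sqr_ge0. Qed.

Fact hsum_norm_ge0 x : 0 <= hsum_norm x.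
Proof. exact: sqrtr_ge0. Qed.

Fact hsum_innerE x : hsum_inner x x = hsum_norm x ^+ 2.
Proof. by rewrite hsum_normsq; apply: eq_bigr => i _; exact: inner_normE. Qed.

Fact hsum_bilinear : bilinear_for *%R (@idfun R \; *%R) hsum_inner.
Proof.
split=> [y c x z|x c y z] /=.
  rewrite /hsum_inner mulr_sumr -big_split/=; apply: eq_bigr => i _.
  by rewrite linearDl linearZl_LR.
rewrite /hsum_inner mulr_sumr -big_split/=; apply: eq_bigr => i _.
by rewrite linearDr linearZr_LR.
Qed.

Fact hsum_herm x y : hsum_inner x y = (-1) ^+ false * idfun (hsum_inner y x).
Proof. by rewrite expr0 mul1r; apply: eq_bigr => i _; exact: innerC. Qed.

Fact hsum_norm_eq0 x : hsum_norm x = 0 -> x = 0.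
Proof.
move=> x0; have : hsum_norm x ^+ 2 = 0 by rewrite x0 expr0n.
rewrite hsum_normsq => /psumr_eq0P => h.
apply: functional_extensionality_dep => i; apply/eqP; rewrite -normr_eq0.
by rewrite -sqrf_eq0 h// => j _; exact: sqr_ge0.
Qed.

Fact hsum_inner_gt0 x : x != 0 -> 0 < hsum_inner x x.
Proof.
move=> x0; rewrite hsum_innerE exprn_gt0// lt_neqAle hsum_norm_ge0 andbT.
by apply: contra x0 => /eqP /esym /hsum_norm_eq0 ->.
Qed.

HB.instance Definition _ := bilinear_isBilinear.Build
  R (hsum H) (hsum H) R *%R (@idfun R \; *%R) hsum_inner hsum_bilinear.
HB.instance Definition _ := isHermitianSesquilinear.Build
  R (hsum H) false (@idfun R) hsum_inner hsum_herm.
HB.instance Definition _ := isDotProduct.Build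
  R (hsum H) hsum_inner hsum_inner_gt0.

Fact hsum_inner_le x y : hsum_inner x y <= hsum_norm x * hsum_norm y.
Proof.
have [x0|x0] := eqVneq (hsum_norm x) 0.
  by rewrite x0 mul0r (hsum_norm_eq0 x0) linear0l.
have [y0|y0] := eqVneq (hsum_norm y) 0.
  by rewrite y0 mulr0 (hsum_norm_eq0 y0) linear0r.
have xy0 : 0 < hsum_norm x * hsum_norm y.
  by rewrite mulr_gt0// lt_def ?x0 ?y0 hsum_norm_ge0.
set s := hsum_norm x in x0 xy0 *; set t := hsum_norm y in y0 xy0 *.
have : 0 <= hsum_inner (t *: x - s *: y) (t *: x - s *: y).
  by rewrite hsum_innerE sqr_ge0.
rewrite linearBl/= !linearBr/= !linearZl_LR/= !linearZr_LR/= !hsum_innerE -/s -/t.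
rewrite [hsum_inner y x]hsum_herm expr0 mul1r.
set p := hsum_inner x y => h.
rewrite -subr_ge0 -(pmulr_rge0 _ xy0) -(pmulr_rge0 _ (ltr0n R 2)).
by move: h; rewrite /GRing.scale/=; congr (0 <= _); ring.
Qed.

Fact hsum_normD x y : hsum_norm (x + y) <= hsum_norm x + hsum_norm y.
Proof.
rewrite -(@ler_pXn2r _ 2)// ?nnegrE ?addr_ge0 ?hsum_norm_ge0//.
rewrite -hsum_innerE linearDl/= !linearDr/= !hsum_innerE.
rewrite [hsum_inner y x]hsum_herm expr0 mul1r sqrrD/= mulr2n !addrA lerD2r.
by rewrite -!addrA lerD2l lerD// hsum_inner_le.
Qed.

Fact hsum_normZ (c : R) x : hsum_norm (c *: x) = `|c| * hsum_norm x.
Proof.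
rewrite /hsum_norm -sqrtr_sqr -sqrtrM ?sqr_ge0// mulr_sumr; congr Num.sqrt.
by apply: eq_bigr => i _; rewrite normrZ exprMn -[in RHS]real_normK ?num_real.
Qed.

HB.instance Definition _ := Lmodule_isNormed.Build R (hsum H)
  hsum_normD hsum_normZ hsum_norm_eq0.

Fact hsum_normE x : `|x| = Num.sqrt (\sum_i `|x i| ^+ 2).
Proof. by []. Qed.

Fact hsum_coord_le x i : `|x i| <= `|x|.
Proof.
rewrite hsum_normE -[leLHS]ger0_norm// -sqrtr_sqr ler_wsqrtr//.
by rewrite (bigD1 i)//= lerDl sumr_ge0// => j _; exact: sqr_ge0.
Qed.

Fact hsum_norm_le x : `|x| <= \sum_i `|x i|.
Proof.
have s0 : 0 <= \sum_i `|x i| by exact: sumr_ge0.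
rewrite hsum_normE -[leRHS]ger0_norm// -sqrtr_sqr ler_wsqrtr//.
rewrite expr2 big_distrl/=; apply: ler_sum => i _; rewrite expr2 ler_wpM2l//.
by rewrite (bigD1 i)//= lerDl sumr_ge0.
Qed.

Fact hsum_complete (F : set_system (hsum H)) :
  ProperFilter F -> cauchy F -> cvg F.
Proof.
move=> FF /(@cauchyP R) Fc.
have Fic i : cvg ((fun x : hsum H => x i) @ F).
  apply: cauchy_cvg; apply/(@cauchy_exP R) => e e0.
  have [x xF] := Fc e e0; exists (x i).
  suff : F [set y : hsum H | ball (x i) e (y i)] by [].
  apply: filterS xF => y; rewrite -!ball_normE/=; apply: le_lt_trans.
  exact: (hsum_coord_le (x - y) i).
pose l : hsum H := fun i => lim ((fun x : hsum H => x i) @ F).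
apply/cvg_ex; exists l; apply/cvgrPdist_lt => e e0.
have d0 : 0 < e / #|I|.+1%:R by rewrite divr_gt0.
have : \forall x \near F, forall i, `|l i - x i| < e / #|I|.+1%:R.
  apply: filter_forall => i; have /cvgrPdist_lt := Fic i.
  exact.
move=> Fl; near=> x.
have lx : forall i, `|l i - x i| < e / #|I|.+1%:R by near: x.
apply: (le_lt_trans (hsum_norm_le (l - x))).
apply: (@le_lt_trans _ _ (\sum_(i : I) e / #|I|.+1%:R)).
  by apply: ler_sum => i _; exact/ltW/lx.
rewrite sumr_const -[ltLHS]mulr_natr -mulrA gtr_pMr//.
by rewrite mulrC ltr_pdivrMr// mul1r ltr_nat.
Unshelve. all: by end_near. Qed.

HB.instance Definition _ := Uniform_isComplete.Build (hsum H) hsum_complete.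

HB.instance Definition _ := CompleteNormedModule_isHilbert.Build R (hsum H)
  hsum_innerE.

Fact hsum_inner_sum x y : inner x y = \sum_i inner (x i) (y i).
Proof. by []. Qed.

End hilbert_sum.

Definition separable_space (T : topologicalType) :=
  exists2 S : set T, countable S & dense S.

Section operators.
Context {R : realType} {V : hilbertType R}.
Implicit Types T : V -> V.

Definition nonexpansive T := 1.-lipschitz T.

Definition averaged (alpha : R) T :=
  nonexpansive T /\
  exists2 Q : V -> V, nonexpansive Q &
    forall x, T x = (1 - alpha) *: x + alpha *: Q x.

Definition Fix T : set V := [set x | T x = x].

End operators.

Section cluster_points.
Context {R : realType} {V : hilbertType R}.
Implicit Types (u : nat -> V) (z : V).

(** By the Riesz representation, testing against vectors is testing against
    continuous linear functionals. *)
Definition weakly_cvg u z :=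
  forall v, inner (u n) v @[n --> \oo] --> inner z v.

Definition strong_cluster u : set V :=
  [set z | exists2 k : nat -> nat, {homo k : i j / (i < j)%N} &
             u (k n) @[n --> \oo] --> z].

Definition weak_cluster u : set V :=
  [set z | exists2 k : nat -> nat, {homo k : i j / (i < j)%N} &
             weakly_cvg (u \o k) z].

End cluster_points.

Notation borel V := (g_sigma_algebraType (@open V)).

Section probability.
Context {d : measure_display} {Omega : measurableType d} {R : realType}.
Variable P : probability Omega R.

Definition sigma_rv {d'} {T : measurableType d'} (X : Omega -> T) :
  set (set Omega) := preimage_set_system setT X measurable.

(** sigma(X_0, ..., X_n), both ends included *)
Definition sigma_rvs {d'} {T : measurableType d'} (X : nat -> Omega -> T)
  (n : nat) : set (set Omega) := g_sigma_preimage (fun k : 'I_n.+1 => X k).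

Definition indep_sigma (G1 G2 : set (set Omega)) :=
  forall A B, G1 A -> G2 B -> P (A `&` B) = (P A * P B)%E.

(** [Z] is a version of E(Y | G), for a nonnegative, not necessarily
    integrable [Y] and a sub-sigma-algebra [G]. *)
Definition cond_exp_version (G : set (set Omega)) (Y Z : Omega -> \bar R) :=
  [/\ sigma_rv Z `<=` G, forall w, (0 <= Z w)%E &
      forall A, G A -> (\int[P]_(w in A) Z w = \int[P]_(w in A) Y w)%E].

End probability.

(** {0,1}^m without the zero vector *)
Definition nonzero_masks (m : nat) : set (m.-tuple bool) :=
  [set e | e != [tuple false | _ < m]].

(* Main.v *)
Require Import Defs.
From mathcomp Require Import all_boot all_order all_algebra.
From mathcomp Require Import sesquilinear.
From mathcomp Require Import all_classical all_reals all_analysis measurable_realfun.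
From mathcomp Require Import ring lra.

Set Implicit Arguments.
Unset Strict Implicit.
Unset Printing Implicit Defensive.

Import Order.TTheory GRing.Theory Num.Theory.
Import numFieldNormedType.Exports.
Import HBNNSimple.

Local Open Scope classical_set_scope.
Local Open Scope ring_scope.

(** Fix a point z of F and measure distances to it with the weighted square
    xi_n = sum_i |x_(i,n) - z_i|^2 / p_i.  Given the past, block i is renewed
    with probability p_i, so that the weights cancel the probabilities: without
    errors, the conditional expectation of xi_(n+1) is
      xi_n - |x_n - z|^2 + |x_n + lambda_n (T_n R_n x_n - x_n) - z|^2,
    and the two averagedness inequalities bound this by xi_n - theta_n, where
    theta_n dominates, up to constants, the squares of the two residuals that
    have to vanish ([averaged_step]).  With errors, Young's inequality with a
    weight g_n, which is of the order of the conditional L2-size of the errors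
    and hence summable, gives
      E(xi_(n+1) | X_n) <= (1 + g_n) (xi_n - theta_n + g_n).
    The Robbins-Siegmund theorem ([robbins_siegmund]) then says that almost
    surely xi_n converges and sum_n theta_n is finite ([quasi_fejer]).

    The second fact makes the residuals vanish for this z.  The vector
    R_n z - z is the same for all z in F ([fixed_residual_eq]), so that one z
    is enough for the first two conclusions, although F may be uncountable.

    For the weak convergence, xi_n converges almost surely for all z in a
    countable dense subset of F, hence for all z in F, because the path is
    bounded ([wsq_cvg_approximable]).  Opial's argument applies to each such
    path: a bounded sequence has weak cluster points ([bounded_weak_cluster]),
    they lie in F, and two of them must coincide, since the difference of the
    squared distances to them is an affine function of the iterate ([opial]).
    A strong cluster point must be the weak limit, so that xi_n for that limit
    tends to 0 along a subsequence and therefore tends to 0 ([weak_to_strong]).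
    The limit is Borel measurable because in a separable space weak
    measurability suffices ([weakly_measurable]).

    Conditional expectations enter only through integrals over the events of
    the past.  An inequality between such integrals may be multiplied by
    nonnegative weights that are measurable with respect to the past
    ([integral_weight_le]), which is all that the supermartingale argument
    behind the Robbins-Siegmund theorem requires. *)

(** * Integrals over the events of a sub-sigma-algebra *)
Section subsigma.
Context {d : measure_display} {Omega : measurableType d} {R : realType}.
Variable P : probability Omega R.
Variable G : set (set Omega).
Hypothesis sG : sigma_algebra setT G.
Hypothesis Gm : G `<=` measurable.

Local Notation OG := (g_sigma_algebraType G).

Lemma wrt_preimage d' (U : measurableType d') (f : OG -> U) (B : set U) :
  measurable_fun setT f -> measurable B -> G (f @^-1` B).
Proof.
move=> mf mB; rewrite -(sigma_algebra_id sG) -[X in <<s _ >> X]setTI.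
exact: (mf measurableT B mB).
Qed.

Lemma wrt_measurable d' (U : measurableType d') (f : OG -> U) :
  measurable_fun setT f -> measurable_fun (setT : set Omega) (f : Omega -> U).
Proof.
by move=> mf _ B mB; rewrite setTI; apply: Gm; exact: wrt_preimage.
Qed.

Lemma integral_weight_simple (f : Omega -> R) (h : {nnsfun OG >-> R}) :
  measurable_fun setT f -> (forall w, 0 <= f w) ->
  (\int[P]_w (h w * f w)%:E =
   \sum_(r \in range h) (r%:E * \int[P]_(w in h @^-1` [set r]) (f w)%:E))%E.
Proof.
move=> mf f0.
have mh : measurable_fun (setT : set OG) h by exact: measurable_funP.
have h0 w : 0 <= h w by exact: fun_ge0.
have mA r : d.-measurable (h @^-1` [set r] : set Omega).
  by apply: Gm; apply: (@wrt_preimage _ _ h).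
transitivity (\int[P]_w (\sum_(r \in range h)
     (Num.max r 0)%:E * ((EFin \o f) \_ (h @^-1` [set r])) w))%E.
  apply: eq_integral => w _.
  rewrite (fsbigD1 (h w))//=; last by exists w.
  rewrite patchE mem_set//= max_l//.
  rewrite fsbig1 ?adde0// => r [_ /= rhw].
  by rewrite patchE memNset ?mule0//= => hr; apply: rhw.
rewrite ge0_integral_fsum//.
- apply: eq_fsbigr => r; rewrite inE => -[w _ <-].
  rewrite max_l//.
  rewrite ge0_integralZl_EFin//; first by rewrite [in RHS]integral_mkcond.
  + by move=> v _; rewrite patchE; case: ifP => //= _; rewrite lee_fin.
  + apply/(measurable_restrictT _ _).1 => //.
    by apply: measurable_funTS; exact/measurable_EFinP.
- move=> r; apply: measurable_funeM.
  apply/(measurable_restrictT _ _).1 => //.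
  by apply: measurable_funTS; exact/measurable_EFinP.
- move=> r w _; rewrite mule_ge0// ?lee_fin ?le_max ?lexx ?orbT//.
  by rewrite patchE; case: ifP => //= _; rewrite lee_fin.
Qed.

(** The form taken here by pulling a known factor out of a conditional
    expectation.  For a simple weight both sides are combinations of integrals
    over level sets of the weight, which belong to [G]; monotone convergence
    does the rest. *)
Lemma integral_weight_le (f g : Omega -> R) (phi : OG -> R) :
  measurable_fun setT f -> measurable_fun setT g ->
  (forall w, 0 <= f w) -> (forall w, 0 <= g w) ->
  (forall A, G A -> \int[P]_(w in A) (f w)%:E <= \int[P]_(w in A) (g w)%:E)%E ->
  measurable_fun setT phi -> (forall w, 0 <= phi w) ->
  (\int[P]_w (phi w * f w)%:E <= \int[P]_w (phi w * g w)%:E)%E.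
Proof.
move=> mf mg f0 g0 fg mphi phi0.
have mphi' : measurable_fun setT (EFin \o phi) by exact/measurable_EFinP.
pose h := nnsfun_approx measurableT mphi'.
have h0 n w : 0 <= h n w by exact: fun_ge0.
have mh n : measurable_fun (setT : set OG) (h n) by exact: measurable_funP.
have cvgh (u : Omega -> R) : measurable_fun setT u -> (forall w, 0 <= u w) ->
    (\int[P]_w (h n w * u w)%:E @[n --> \oo] --> \int[P]_w (phi w * u w)%:E)%E.
  move=> mu u0.
  have -> : (\int[P]_w (phi w * u w)%:E =
     \int[P]_w (limn (fun n => (h n w * u w)%:E)))%E.
    apply: eq_integral => w _; apply/esym/cvg_lim => //.
    under eq_fun do rewrite EFinM. rewrite EFinM.
    apply: cvgeZr => //; apply: cvg_nnsfun_approx => //.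
    by move=> t _; rewrite lee_fin.
  apply: cvg_monotone_convergence => //.
  - by move=> n; apply/measurable_EFinP/measurable_funM => //; exact: wrt_measurable.
  - by move=> n w _; rewrite lee_fin mulr_ge0.
  - move=> w _ i j ij; rewrite lee_fin; apply: ler_wpM2r => //.
    by have /lefP := nd_nnsfun_approx measurableT mphi' ij; exact.
have := @lee_lim _ _ _ _ _ _ (cvgP _ (cvgh _ mf f0)) (cvgP _ (cvgh _ mg g0)).
rewrite (cvg_lim _ (cvgh _ mf f0))// (cvg_lim _ (cvgh _ mg g0))//; apply.
near=> n; rewrite !integral_weight_simple//.
apply: lee_fsum => [|r [w _ <-]]; first exact: fimfunP.
by rewrite lee_wpmul2l// ?lee_fin//; apply: fg; exact: wrt_preimage.
Unshelve. all: by end_near. Qed.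
End subsigma.

Lemma ae_forall_count {d : measure_display} {T : measurableType d} {R : realType}
    (mu : {measure set T -> \bar R}) (I : countType) (Q : I -> T -> Prop) :
  (forall i, {ae mu, forall w, Q i w}) -> {ae mu, forall w i, Q i w}.
Proof.
move=> aeQ; pose N n : set T :=
  if unpickle n is Some i then [set w | ~ Q i w] else set0.
apply: (@negligibleS _ _ _ _ (\bigcup_n N n)).
  move=> w /= /existsNP[i nQ]; exists (pickle i) => //.
  by rewrite /N pickleK.
apply: negligible_bigcup => n; rewrite /N; case: unpickle => [i|].
  exact: aeQ.
exact: negligible_set0.
Qed.

(** * Convergence of nonnegative supermartingales *)
Section crossing.
Context {R : realType}.
Implicit Types u : nat -> R.

(** The limit is the infimum of the eventual upper bounds: no number below it
    is an eventual upper bound, so that by the absence of crossings smaller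
    positive numbers are eventual lower bounds.  Boundedness along a subsequence
    excludes divergence to infinity, which crosses no band infinitely often. *)
Lemma cvg_no_crossing u : (forall n, 0 <= u n) ->
  (exists K : R, forall N, exists2 n, (N <= n)%N & u n <= K) ->
  (forall p q : rat, 0 < ratr p :> R -> p < q ->
    (\forall n \near \oo, u n <= ratr q) \/ (\forall n \near \oo, ratr p <= u n)) ->
  cvgn u.
Proof.
move=> u0 [K uK] ucr.
pose E := [set b : R | \forall n \near \oo, u n <= b].
have E0 : E !=set0.
  have [p] := @rat_in_itvoo R `|K| (`|K| + 1) (ltr_pwDr ltr01 (lexx _)).
  rewrite in_itv/= => /andP[Kp _].
  exists (ratr (p + 1)); have [||//|[N _ pu]] := ucr p (p + 1).
  - exact: le_lt_trans Kp.
  - by rewrite ltrDl.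
  - have [n Nn unK] := uK N.
    have := le_trans (pu n Nn) unK.
    by rewrite leNgt => /negP[]; exact: le_lt_trans (ler_norm _) Kp.
have lbE : lbound E 0.
  by move=> b [N _ ub]; apply: le_trans (u0 N) _; apply: ub => /=.
have infE : has_inf E by split=> //; exists 0.
apply/cvg_ex; exists (inf E); apply/cvgrPdist_le => e e0.
have [b Eb bi] := inf_adherent e0 infE.
have low : \forall n \near \oo, inf E - e <= u n.
  have [le0|lt0] := leP (inf E - e) 0.
    by apply: nearW => n; exact: le_trans le0 _.
  have h2 : inf E - e < inf E by rewrite gtrBl.
  have [q] := rat_in_itvoo h2; rewrite in_itv/= => /andP[q1 q2].
  have [p] := rat_in_itvoo q1; rewrite in_itv/= => /andP[p1 p2].
  have [||qu|pu] := ucr p q.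
  - exact: lt_trans p1.
  - by rewrite -(ltr_rat R).
  - have : inf E <= ratr q by apply: inf_lbound => //; exists 0.
    by rewrite leNgt q2.
  - by apply: filterS pu => n; apply: le_trans; exact: ltW.
near=> n; rewrite ler_distlC; apply/andP; split.
  by near: n.
apply: le_trans (ltW bi); near: n; exact: Eb.
Unshelve. all: by end_near. Qed.

End crossing.

Lemma measurable_fun_subsigma {d' : measure_display} {T : pointedType}
    {U : measurableType d'} (G1 G2 : set (set T)) (f : T -> U) :
  G1 `<=` G2 ->
  measurable_fun (setT : set (g_sigma_algebraType G1)) f ->
  measurable_fun (setT : set (g_sigma_algebraType G2)) f.
Proof.
move=> G12 mf mT B mB; have := mf measurableT B mB.
exact: sub_sigma_algebra2.
Qed.

Section supermartingale.
Context {d : measure_display} {Omega : measurableType d} {R : realType}.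
Variable P : probability Omega R.
Variable G : nat -> set (set Omega).
Hypothesis sG : forall n, sigma_algebra setT (G n).
Hypothesis Gm : forall n, G n `<=` measurable.
Hypothesis GS : forall n, G n `<=` G n.+1.

Local Notation OG n := (g_sigma_algebraType (G n)).

Variable M : nat -> Omega -> R.
Hypothesis M0 : forall n w, 0 <= M n w.
Hypothesis mM : forall n, measurable_fun (setT : set (OG n)) (M n).
Hypothesis superM : forall n A, G n A ->
  (\int[P]_(w in A) (M n.+1 w)%:E <= \int[P]_(w in A) (M n w)%:E)%E.

Let mM' n : measurable_fun (setT : set Omega) (M n).
Proof. exact: (wrt_measurable (sG n) (@Gm n)). Qed.

Section upcrossing.
Variables a b : R.
Hypotheses (a0 : 0 < a) (ab : a < b).

(** The path has been below [a] and has not been above [b] since then. *)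
Fixpoint climbing n w : bool :=
  if n is n'.+1 then if climbing n' w then M n w <= b else M n w < a
  else M 0 w < a.

Fixpoint upcrossings n w : nat :=
  if n is n'.+1 then (upcrossings n' w + (climbing n' w && (b < M n w)%R))%N
  else 0%N.

Let climbing_measurable n : measurable_fun (setT : set (OG n)) (climbing n).
Proof.
elim: n => [|n ih] /=; first exact: measurable_fun_ltr.
apply: measurable_fun_ifT; first exact: measurable_fun_subsigma ih.
- exact: measurable_fun_ler.
- exact: measurable_fun_ltr.
Qed.

Let climbing_measurableT n : measurable_fun (setT : set Omega) (climbing n).
Proof. exact: (wrt_measurable (sG n) (@Gm n)). Qed.

Let upcrossings_measurable n :
  measurable_fun (setT : set Omega) (fun w => (upcrossings n w)%:R : R).
Proof.
elim: n => [|n ih] /=; first exact: measurable_cst.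
under eq_fun do rewrite natrD.
apply: measurable_funD => //.
have -> : (fun w => (climbing n w && (b < M n.+1 w))%:R : R) =
    (fun w => if climbing n w && (b < M n.+1 w) then 1 else 0).
  by apply/funext => w; case: ifP.
apply: measurable_fun_ifT; last 2 first; try exact: measurable_cst.
by apply: measurable_and => //; exact: measurable_fun_ltr.
Qed.

(* A potential for Doob's upcrossing inequality.  While the path climbs, W moves
   with M; otherwise it is frozen at the value that it would have if M were
   equal to a.  Starting to climb from below a only decreases it, and ending
   the climb above b decreases it too, even after b - a has been paid for the
   upcrossing. *)
Let W n w : R := (b - a) * (upcrossings n w)%:R + (if climbing n w then M n w else a).

Let W_measurable n : measurable_fun (setT : set Omega) (W n).
Proof.
apply: measurable_funD; first exact: measurable_funM.
exact: measurable_fun_ifT.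
Qed.

Let W_ge0 n w : 0 <= W n w.
Proof.
rewrite addr_ge0//; first by rewrite mulr_ge0// subr_ge0 ltW.
by case: ifP => // _; exact: ltW.
Qed.

Let W_decr n : (\int[P]_w (W n.+1 w)%:E <= \int[P]_w (W n w)%:E)%E.
Proof.
pose V w := (b - a) * (upcrossings n w)%:R + (if climbing n w then 0 else a).
have V0 w : 0 <= V w.
  rewrite addr_ge0//; first by rewrite mulr_ge0// subr_ge0 ltW.
  by case: ifP => // _; exact: ltW.
have mV : measurable_fun setT V.
  apply: measurable_funD; first exact: measurable_funM.
  exact: measurable_fun_ifT.
pose C := [set w | climbing n w].
have GC : G n C.
  have := @wrt_preimage _ _ _ (sG n) _ _ (climbing n) [set true] (@climbing_measurable n).
  exact.
have mC : measurable C by exact: (@Gm n).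
have iC0 w : 0 <= \1_C w :> R by rewrite indicE.
have dec k : (\int[P]_w (V w + \1_C w * M k w)%:E =
    \int[P]_w (V w)%:E + \int[P]_(w in C) (M k w)%:E)%E.
  under eq_integral do rewrite EFinD.
  rewrite ge0_integralD//=.
  - congr (_ + _)%E; rewrite [in RHS]integral_mkcond; apply: eq_integral => w _.
    by rewrite patchE indicE; case: ifP => wC; rewrite ?mul1r ?mul0r.
  - by move=> w _; rewrite lee_fin.
  - exact/measurable_EFinP.
  - by move=> w _; rewrite lee_fin mulr_ge0.
  - by apply/measurable_EFinP/measurable_funM => //; exact: measurable_indic.
have WV w : W n w = V w + \1_C w * M n w.
  rewrite /W /V indicE; case: ifPn => cw.
    by rewrite mem_set//= mul1r addr0.
  by rewrite memNset/= ?mul0r ?addr0//; exact/negP.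
have WSV w : W n.+1 w <= V w + \1_C w * M n.+1 w.
  rewrite /W /V indicE /=; have [cw|cw] := boolP (climbing n w).
    rewrite mem_set//= mul1r addr0 natrD mulrDr -addrA lerD2l.
    have [_|bM] := leP (M n.+1 w) b; first by rewrite mulr0 add0r.
    by rewrite mulr1 subrK ltW.
  rewrite memNset/= ?mul0r ?addr0 ?addn0//; last exact/negP.
  by rewrite lerD2l; case: ifPn => // /ltW.
have -> : (\int[P]_w (W n w)%:E = \int[P]_w (V w + \1_C w * M n w)%:E)%E.
  by apply: eq_integral => w _; rewrite WV.
rewrite dec; apply: le_trans (leeD2l _ (superM GC)); rewrite -dec.
apply: ge0_le_integral => //.
- by move=> w _; rewrite lee_fin.
- exact/measurable_EFinP.
- apply/measurable_EFinP/measurable_funD => //.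
  by apply: measurable_funM => //; exact: measurable_indic.
- by move=> w _; rewrite lee_fin.
Qed.

(** The expectation of the potential decreases from at most [a], so that the
    expected number of upcrossings is at most [a / (b - a)]. *)
Lemma upcrossings_bounded :
  {ae P, forall w, exists K : nat, forall n, (upcrossings n w <= K)%N}.
Proof.
have ndu w : nondecreasing_seq (fun n => (upcrossings n w)%:R%:E : \bar R).
  apply/nondecreasing_seqP => n; rewrite lee_fin ler_nat /=; exact: leq_addr.
have mu n : measurable_fun setT (fun w => (upcrossings n w)%:R%:E : \bar R).
  exact/measurable_EFinP.
pose U w := limn (fun n => (upcrossings n w)%:R%:E : \bar R).
have U0 w : (0 <= U w)%E.
  apply: lime_ge; first exact: ereal_nondecreasing_is_cvgn.
  by apply: nearW => n; rewrite lee_fin.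
have mU : measurable_fun setT U.
  apply: (emeasurable_fun_cvg (fun n w => (upcrossings n w)%:R%:E)) => // w _.
  exact: ereal_nondecreasing_is_cvgn.
have ba0 : 0 < b - a by rewrite subr_gt0.
have Ule : (\int[P]_w U w <= (a / (b - a))%:E)%E.
  rewrite monotone_convergence//; last first.
  apply: lime_le.
    apply: ereal_nondecreasing_is_cvgn => m n mn.
    by apply: ge0_le_integral => // w _; rewrite ?lee_fin//; exact: ndu.
  apply: nearW => n.
  rewrite EFinM muleC lee_pdivlMl//.
  have Wa : (\int[P]_w (W n w)%:E <= a%:E)%E.
    elim: n => [|n ih]; last exact: le_trans (W_decr n) ih.
    apply: (@le_trans _ _ (\int[P]_w (cst a%:E w))%E).
      apply: ge0_le_integral => //.
      - by move=> w _; rewrite lee_fin.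
      - exact/measurable_EFinP.
      - by move=> w _; rewrite /W/= mulr0 add0r lee_fin; case: ifPn => // /ltW.
    rewrite integral_cst// [X in (_ * X)%E](_ : _ = 1%E) ?mule1//.
    exact: probability_setT.
  apply: le_trans Wa; rewrite -ge0_integralZl_EFin//; last exact: ltW.
  apply: ge0_le_integral => //.
  - by move=> w _; rewrite -EFinM lee_fin mulr_ge0// ltW.
  - exact: measurable_funeM.
  - exact/measurable_EFinP.
  - move=> w _; rewrite -EFinM lee_fin /W lerDl; case: ifP => // _; exact: ltW.
have Ui : P.-integrable setT U.
  apply/integrableP; split=> //.
  under eq_integral do rewrite gee0_abs//.
  exact: le_lt_trans Ule (ltry _).
have := integrable_ae measurableT Ui; apply: filterS => w /(_ I) Uw.
exists (Num.truncn (fine (U w))) => n.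
rewrite truncn_ge_nat ?fine_ge0// -lee_fin fineK//.
rewrite /U (cvg_lim _ (ereal_nondecreasing_cvgn (ndu w)))//.
by apply: ereal_sup_ubound; exists n.
Qed.

(** Once the last upcrossing is over, a path that climbs never exceeds [b],
    and a path that does not climb never goes below [a]. *)
Lemma no_crossing w :
  (exists K : nat, forall n, (upcrossings n w <= K)%N) ->
  (\forall n \near \oo, M n w <= b) \/ (\forall n \near \oo, a <= M n w).
Proof.
move=> [K uK].
have ndu n k : (upcrossings n w <= upcrossings (n + k) w)%N.
  elim: k => [|k ih]; first by rewrite addn0.
  by rewrite addnS; apply: leq_trans ih _; exact: leq_addr.
have [N uN] : exists N, forall n, (N <= n)%N -> upcrossings n w = upcrossings N w.
  have ex : exists k, `[< exists n, upcrossings n w = k >].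
    by exists (upcrossings 0 w); apply/asboolP; exists 0%N.
  have ub k : `[< exists n, upcrossings n w = k >] -> (k <= K)%N.
    by move=> /asboolP[n <-].
  case: (ex_maxnP ex ub) => k /asboolP[N uN] maxk; exists N => n Nn.
  apply/eqP; rewrite eqn_leq -{2}(subnKC Nn) ndu andbT uN.
  by apply: maxk; apply/asboolP; exists n.
have stay n : (N <= n)%N -> climbing n w -> climbing n.+1 w /\ M n.+1 w <= b.
  move=> Nn cn; have := uN n.+1 (leqW Nn).
  rewrite -(uN n Nn) /= cn /= => /eqP; rewrite -[X in _ == X]addn0 eqn_add2l.
  by have [//|] := leP (M n.+1 w) b.
have [[n Nn cn]|nc] := pselect (exists2 n, (N <= n)%N & climbing n w).
  left; have ck k : climbing (n + k) w.
    elim: k => [|k ih]; first by rewrite addn0.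
    by rewrite addnS; apply: (stay _ _ ih).1; exact: leq_trans Nn (leq_addr _ _).
  exists n.+1 => // -[|m] //= nm; apply: (stay m _ _).2.
    exact: leq_trans Nn _.
  by rewrite -(subnKC (nm : (n <= m)%N)).
right; exists N.+1 => // -[|n] //= Nn; rewrite leNgt; apply/negP => Ma.
have ncn : ~~ climbing n w by apply/negP => cn; apply: nc; exists n.
by apply: nc; exists n.+1; [exact: leqW|rewrite /= (negbTE ncn)].
Qed.

End upcrossing.

Lemma supermartingale_integral_le n :
  (\int[P]_w (M n w)%:E <= \int[P]_w (M 0 w)%:E)%E.
Proof.
elim: n => // n; apply: le_trans; apply: superM.
by have [] := sG n => G0 /(_ _ G0); rewrite setD0.
Qed.

(** The upcrossing bounds for the countably many rational bands exclude
    oscillation, and Fatou's lemma excludes divergence to infinity. *)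
Lemma supermartingale_cvg : (\int[P]_w (M 0 w)%:E < +oo)%E ->
  {ae P, forall w, cvgn (fun n => M n w)}.
Proof.
move=> M0oo.
have mE n : measurable_fun setT (fun w => (M n w)%:E) by exact/measurable_EFinP.
pose L w := limn_einf (fun n => (M n w)%:E).
have L0 w : (0 <= L w)%E.
  rewrite /L limn_einf_lim; apply: lime_ge; first exact: is_cvg_einfs.
  by apply: nearW => n; apply: le_ereal_inf_tmp => _ [k _ <-]; rewrite lee_fin.
have mL : measurable_fun setT L.
  have -> : L = (fun w => limn (einfs (fun n => (M n w)%:E))).
    by apply/funext => w; rewrite /L limn_einf_lim.
  apply: (emeasurable_fun_cvg (fun n w => einfs (fun n => (M n w)%:E) n)).
    exact: measurable_fun_einfs.
  by move=> w _; exact: is_cvg_einfs.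
have Li : P.-integrable setT L.
  apply/integrableP; split=> //.
  under eq_integral do rewrite gee0_abs//.
  apply: le_lt_trans M0oo.
  apply: le_trans (fatou _ _ _ _) _ => //; first by move=> n w _; rewrite lee_fin.
  rewrite limn_einf_lim; apply: lime_le; first exact: is_cvg_einfs.
  apply: nearW => n; apply: le_trans (supermartingale_integral_le n).
  by apply: ereal_inf_lbound; exists n => /=.
have aeL := integrable_ae measurableT Li.
have aeU : {ae P, forall w (pq : rat * rat), 0 < ratr pq.1 :> R -> pq.1 < pq.2 ->
    (\forall n \near \oo, M n w <= ratr pq.2) \/ (\forall n \near \oo, ratr pq.1 <= M n w)}.
  apply: ae_forall_count => -[p q] /=.
  have [p0|p0] := ltP 0 (ratr p : R); last by apply: aeW.
  have [pq|pq] := ltP p q; last by apply: aeW.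
  have := @upcrossings_bounded (ratr p) (ratr q) p0.
  rewrite ltr_rat => /(_ pq); apply: filterS => w wb _ _.
  apply: no_crossing => //; by rewrite ltr_rat.
apply: filterS2 aeL aeU => w /(_ I) Lw Uw.
apply: cvg_no_crossing => // [|p q p0 pq]; last exact: (Uw (p, q)).
apply: contrapT => /forallNP unb; move: Lw; rewrite /L.
suff -> : limn_einf (fun n => (M n w)%:E) = +oo%E by [].
suff /cvg_limn_einf_sup[-> _] : (M n w)%:E @[n --> \oo] --> +oo%E by [].
apply/cvgeyPge => A; have /existsNP[N uN] := unb A.
exists N => // n /= Nn; rewrite lee_fin leNgt; apply/negP => /ltW MA.
by apply: uN; exists n.
Qed.

End supermartingale.

Lemma integral_indicatorE {d : measure_display} {T : measurableType d}
    {R : realType} (mu : {measure set T -> \bar R}) (A : set T) (f : T -> R) :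
  (\int[mu]_(w in A) (f w)%:E = \int[mu]_w (\1_A w * f w)%:E)%E.
Proof.
rewrite integral_mkcond; apply: eq_integral => w _.
by rewrite patchE indicE; case: ifP; rewrite ?mul1r ?mul0r.
Qed.

(** * The Robbins-Siegmund theorem *)
Section robbins_siegmund_path.
Context {R : realType}.
Variables xi theta g : nat -> R.
Hypotheses (xi0 : forall n, 0 <= xi n) (theta0 : forall n, 0 <= theta n).
Hypotheses (g0 : forall n, 0 <= g n).

Let pr n : R := \prod_(0 <= k < n) (1 + g k).

Let pr_ge1 n : 1 <= pr n.
Proof.
rewrite /pr; elim: n => [|n ih]; first by rewrite big_geq.
rewrite big_nat_recr//=; apply: (le_trans ih).
by rewrite ler_peMr ?lerDl//; apply: le_trans ih.
Qed.

Let pr_le_expR n : pr n <= expR (series g n).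
Proof.
rewrite /pr/series/=; elim: n => [|n ih]; first by rewrite !big_geq// expR0.
rewrite !big_nat_recr//= expRD ler_pM ?expR_ge1Dx//.
- by apply: le_trans (pr_ge1 n).
- by rewrite addr_ge0.
Qed.

Let pr_nd : nondecreasing_seq pr.
Proof.
apply/nondecreasing_seqP => n; rewrite /pr big_nat_recr//= -/(pr n).
rewrite mulrDr mulr1 lerDl mulr_ge0//; exact: le_trans (pr_ge1 n).
Qed.

(** Since the sum of [g] is finite, the products [pr n] increase to a finite
    limit, so that dividing by them affects neither the convergence of [xi] nor
    the summability of [theta]. *)
Lemma robbins_siegmund_path : cvgn (series g) ->
  cvgn (fun n => xi n / pr n + \sum_(0 <= k < n) theta k / pr k) ->
  cvgn xi /\ cvgn (series theta).
Proof.
move=> cg cM; pose c := limn (series g).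
have gle n : series g n <= c.
  apply: nondecreasing_cvgn_le => //; apply/nondecreasing_seqP => k.
  by rewrite /series/= big_nat_recr//= lerDl.
have pr0 n : 0 < pr n by exact: lt_le_trans (pr_ge1 n).
have prc n : pr n <= expR c.
  by apply: le_trans (pr_le_expR n) _; rewrite ler_expR.
have cpr : cvgn pr.
  by apply: nondecreasing_is_cvgn => //; exists (expR c) => _ [n _ <-].
have tp0 k : 0 <= theta k / pr k by rewrite divr_ge0// ltW.
pose Q n := \sum_(0 <= k < n) theta k / pr k.
have ndQ : nondecreasing_seq Q.
  by apply/nondecreasing_seqP => n; rewrite /Q big_nat_recr//= lerDl.
have [B QB] : exists B, forall n, Q n <= B.
  have /cvg_seq_bounded [B [_ BM]] := cM.
  exists (B + 1) => n; have /= := BM (B + 1) (ltr_pwDr ltr01 (lexx _)) n I.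
  by apply: le_trans; apply: le_trans (ler_norm _); rewrite lerDr divr_ge0// ltW.
have cQ : cvgn Q by apply: nondecreasing_is_cvgn => //; exists B => _ [n _ <-].
have cxp : cvgn (fun n => xi n / pr n).
  have -> : (fun n => xi n / pr n) = (fun n => xi n / pr n + Q n) - Q.
    by apply/funext => n; rewrite /= !fctE addrK.
  exact: is_cvgB.
split.
  have -> : xi = (fun n => xi n / pr n) * pr.
    by apply/funext => n; rewrite !fctE divfK// gt_eqF.
  exact: is_cvgM.
apply: nondecreasing_is_cvgn.
  by apply/nondecreasing_seqP => n; rewrite /series/= big_nat_recr//= lerDl.
exists (expR c * B) => _ [n _ <-].
apply: (@le_trans _ _ (expR c * Q n)); last first.
  by rewrite ler_wpM2l// expR_ge0.
rewrite /series/= /Q mulr_sumr; apply: ler_sum => k _.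
rewrite mulrCA ler_peMr// ler_pdivlMr ?mul1r//; exact: prc.
Qed.
End robbins_siegmund_path.

Lemma measurable_funV_ge0 {d : measure_display} {T : measurableType d}
    {R : realType} (f : T -> R) :
  measurable_fun setT f -> (forall w, 0 <= f w) ->
  measurable_fun setT (fun w => (f w)^-1).
Proof.
move=> mf f0; have -> : (fun w => (f w)^-1) = (@powR R ^~ (-1)) \o f.
  by apply/funext => w /=; rewrite powR_inv1.
exact: measurableT_comp (measurable_powR _) mf.
Qed.

Section robbins_siegmund.
Context {d : measure_display} {Omega : measurableType d} {R : realType}.
Variable P : probability Omega R.
Variable G : nat -> set (set Omega).
Hypothesis sG : forall n, sigma_algebra setT (G n).
Hypothesis Gm : forall n, G n `<=` measurable.
Hypothesis GS : forall n, G n `<=` G n.+1.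

Local Notation OG n := (g_sigma_algebraType (G n)).

Lemma adapted_sum (f : nat -> Omega -> R) :
  (forall n, measurable_fun (setT : set (OG n)) (f n)) ->
  forall n, measurable_fun (setT : set (OG n)) (fun w => \sum_(0 <= k < n.+1) f k w).
Proof.
move=> mf; elim=> [|n ih].
  under eq_fun do rewrite big_nat1. exact: mf.
under eq_fun do rewrite big_nat_recr//=.
by apply: measurable_funD => //; exact: measurable_fun_subsigma (@GS n) ih.
Qed.

Lemma adapted_prod (f : nat -> Omega -> R) :
  (forall n, measurable_fun (setT : set (OG n)) (f n)) ->
  forall n, measurable_fun (setT : set (OG n)) (fun w => \prod_(0 <= k < n.+1) f k w).
Proof.
move=> mf; elim=> [|n ih].
  under eq_fun do rewrite big_nat1. exact: mf.
under eq_fun do rewrite big_nat_recr//=.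
by apply: measurable_funM => //; exact: measurable_fun_subsigma (@GS n) ih.
Qed.

Lemma predictable_adapted (f : nat -> Omega -> R) (c : R) :
  (forall n, measurable_fun (setT : set (OG n)) (f n.+1)) ->
  f 0 = cst c ->
  forall n, measurable_fun (setT : set (OG n)) (f n).
Proof.
move=> mf f0 [|n]; first by rewrite f0; exact: measurable_cst.
exact: measurable_fun_subsigma (@GS n) (mf n).
Qed.

Variables xi theta g : nat -> Omega -> R.
Hypotheses (xi0 : forall n w, 0 <= xi n w) (theta0 : forall n w, 0 <= theta n w).
Hypotheses (g0 : forall n w, 0 <= g n w).
Hypothesis mxi : forall n, measurable_fun (setT : set (OG n)) (xi n).
Hypothesis mtheta : forall n, measurable_fun (setT : set (OG n)) (theta n).
Hypothesis mg : forall n, measurable_fun (setT : set (OG n)) (g n).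
Hypothesis xi_step : forall n A, G n A ->
  (\int[P]_(w in A) (xi n.+1 w + (1 + g n w) * theta n w)%:E <=
   \int[P]_(w in A) ((1 + g n w) * (xi n w + g n w))%:E)%E.

Let pr n w : R := \prod_(0 <= k < n) (1 + g k w).
Let sm n w : R := \sum_(0 <= k < n) g k w.
Let Q n w : R := \sum_(0 <= k < n) theta k w / pr k w.

Let mpr1 n : measurable_fun (setT : set (OG n)) (pr n.+1).
Proof.
by apply: adapted_prod => k; apply: measurable_funD.
Qed.

Let mpr n : measurable_fun (setT : set (OG n)) (pr n).
Proof.
apply: (@predictable_adapted _ 1) => //.
by apply/funext => w; rewrite /pr big_geq.
Qed.

Let msm1 n : measurable_fun (setT : set (OG n)) (sm n.+1).
Proof. exact: adapted_sum. Qed.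

Let msm n : measurable_fun (setT : set (OG n)) (sm n).
Proof.
apply: (@predictable_adapted _ 0) => //.
by apply/funext => w; rewrite /sm big_geq.
Qed.

Let pr_gt0 n w : 0 < pr n w.
Proof. by apply: prodr_gt0 => k _; rewrite ltr_pwDl. Qed.

Let mQ n : measurable_fun (setT : set (OG n)) (Q n).
Proof.
apply: (@predictable_adapted _ 0); last first.
  by apply/funext => w; rewrite /Q big_geq.
move=> k; apply: adapted_sum => j; apply: measurable_funM => //.
by apply: measurable_funV_ge0 => // w; exact: ltW.
Qed.

Section level.
Variable c : R.
Hypothesis c0 : 0 <= c.

(* The process M is made nonnegative by the constant c and by killing it as
   soon as the sum of the g_k exceeds c.  This sum up to the index n is known
   one step ahead, so that killing does not use the future; killing a
   nonnegative process can only decrease it.  The bound on xi_0 makes M_0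
   integrable. *)
Let K n : set Omega := [set w | xi 0 w <= c] `&` [set w | sm n w <= c].

Let M n w : R := \1_(K n) w * (xi n w / pr n w + Q n w + (c - sm n w)).

Let xi0_adapted n : measurable_fun (setT : set (OG n)) (xi 0).
Proof.
elim: n => // n ih; exact: measurable_fun_subsigma (@GS n) ih.
Qed.

Let K_adapted n (f : Omega -> R) : measurable_fun (setT : set (OG n)) f ->
  G n ([set w | xi 0 w <= c] `&` [set w | f w <= c]).
Proof.
move=> mf; pose b w := (xi 0 w <= c) && (f w <= c).
have mb : measurable_fun (setT : set (OG n)) b.
  by apply: measurable_and; apply: measurable_fun_ler.
have := @wrt_preimage _ _ _ (sG n) _ _ b [set true] mb I.
by congr (G n _); apply/seteqP; split=> w /=; rewrite /b => /andP.
Qed.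

Let GK n : G n (K n). Proof. exact: K_adapted. Qed.
Let GK1 n : G n (K n.+1). Proof. exact: K_adapted. Qed.

Let K_decr n : K n.+1 `<=` K n.
Proof.
move=> w [/= h1 h2]; split=> //=; apply: le_trans h2.
by rewrite /sm big_nat_recr//= lerDl.
Qed.

Let Q_ge0 n w : 0 <= Q n w.
Proof. by apply: sumr_ge0 => k _; rewrite divr_ge0// ltW. Qed.

Let M_ge0 n w : 0 <= M n w.
Proof.
rewrite /M indicE; have [Kw|nKw] := pselect (K n w); last first.
  by rewrite memNset//= mul0r.
rewrite mem_set//= mul1r; apply: addr_ge0; last by rewrite subr_ge0; case: Kw.
by apply: addr_ge0 => //; rewrite divr_ge0// ltW.
Qed.

Let mM n : measurable_fun (setT : set (OG n)) (M n).
Proof.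
apply: measurable_funM.
  by apply: measurable_indic; apply: sub_sigma_algebra; exact: GK.
apply: measurable_funD; last exact: measurable_funB.
apply: measurable_funD => //; apply: measurable_funM => //.
by apply: measurable_funV_ge0 => // w; exact: ltW.
Qed.

Let M_super n A : G n A ->
  (\int[P]_(w in A) (M n.+1 w)%:E <= \int[P]_(w in A) (M n w)%:E)%E.
Proof.
move=> GA.
pose B := A `&` K n.+1.
have GB : G n B.
  rewrite -(sigma_algebra_id (sG n)).
  by apply: (@measurableI _ (OG n)); apply: sub_sigma_algebra.
pose phi w : R := \1_B w / pr n.+1 w.
pose f w : R := xi n.+1 w + (1 + g n w) * theta n w.
pose h w : R := (1 + g n w) * (xi n w + g n w).
pose r w : R := \1_B w * (Q n w + (c - sm n.+1 w)).
have iB0 w : 0 <= \1_B w :> R by rewrite indicE.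
have phi0 w : 0 <= phi w by rewrite divr_ge0// ltW.
have f0 w : 0 <= f w by rewrite addr_ge0// mulr_ge0// addr_ge0.
have h0 w : 0 <= h w by rewrite mulr_ge0// addr_ge0.
have r0 w : 0 <= r w.
  rewrite /r indicE; have [Kw|nKw] := pselect (B w); last first.
    by rewrite memNset//= mul0r.
  by rewrite mem_set//= mul1r; apply: addr_ge0 => //; rewrite subr_ge0; case: Kw => _ [].
have mphi : measurable_fun (setT : set (OG n)) phi.
  apply: measurable_funM; first by apply: measurable_indic; exact: sub_sigma_algebra.
  by apply: measurable_funV_ge0 => // w; exact: ltW.
have toT k (u : Omega -> R) : measurable_fun (setT : set (OG k)) u ->
    measurable_fun (setT : set Omega) u.
  exact: wrt_measurable.
have mphiT := toT _ _ mphi.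
have mr : measurable_fun (setT : set Omega) r.
  apply: (toT n); apply: measurable_funM.
    by apply: measurable_indic; exact: sub_sigma_algebra.
  by apply: measurable_funD => //; exact: measurable_funB.
have m1g : measurable_fun (setT : set Omega) (fun w => 1 + g n w).
  apply: measurable_funD; [exact: measurable_cst|exact: toT _ _ (@mg n)].
have mf : measurable_fun setT f.
  apply: measurable_funD; first exact: toT _ _ (@mxi n.+1).
  by apply: measurable_funM => //; exact: toT _ _ (@mtheta n).
have mh : measurable_fun setT h.
  apply: measurable_funM => //.
  by apply: measurable_funD; [exact: toT _ _ (@mxi n)|exact: toT _ _ (@mg n)].
have split_int (u : Omega -> R) : measurable_fun setT u -> (forall w, 0 <= u w) ->
    (\int[P]_w (phi w * u w + r w)%:E =
     \int[P]_w (phi w * u w)%:E + \int[P]_w (r w)%:E)%E.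
  move=> mu u0; under eq_integral do rewrite EFinD.
  rewrite ge0_integralD//.
  - by move=> w _; rewrite lee_fin mulr_ge0.
  - exact/measurable_EFinP/measurable_funM.
  - by move=> w _; rewrite lee_fin.
  - exact/measurable_EFinP.
have prS w : pr n.+1 w = pr n w * (1 + g n w) by rewrite /pr big_nat_recr.
have QS w : Q n.+1 w = Q n w + theta n w / pr n w by rewrite /Q big_nat_recr.
have smS w : sm n.+1 w = sm n w + g n w by rewrite /sm big_nat_recr.
have g1 w : 1 + g n w != 0 by rewrite gt_eqF// ltr_pwDl.
have pn0 w : pr n w != 0 by rewrite gt_eqF.
rewrite integral_indicatorE [leRHS]integral_indicatorE.
have -> : (\int[P]_w (\1_A w * M n.+1 w)%:E = \int[P]_w (phi w * f w + r w)%:E)%E.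
  apply: eq_integral => w _; congr EFin.
  rewrite /M /phi /r mulrA /B indicI/= /f QS prS.
  by field; rewrite g1 pn0.
rewrite split_int//.
have le1 := integral_weight_le (sG n) (@Gm n) mf mh f0 h0 (@xi_step n) mphi phi0.
apply: le_trans (leeD2r _ le1) _; rewrite -split_int//.
apply: ge0_le_integral => //.
- by move=> w _; rewrite lee_fin addr_ge0// mulr_ge0.
- by apply/measurable_EFinP/measurable_funD => //; exact: measurable_funM.
- apply/measurable_EFinP/measurable_funM; last exact: toT _ _ (@mM n).
  by apply: measurable_indic; exact: Gm GA.
move=> w _; rewrite lee_fin.
have [Bw|nBw] := pselect (B w); last first.
  rewrite /phi /r indicE memNset//= !mul0r add0r.
  by apply: mulr_ge0; [rewrite indicE|exact: M_ge0].
have [Aw Kw] := Bw; have Knw := K_decr Kw.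
rewrite /phi /r /M !indicE !mem_set//= !mul1r /h prS smS.
rewrite invfM -mulrA mulKf// mulrDr [_ * xi n w]mulrC.
have : (pr n w)^-1 * g n w <= g n w.
  rewrite ler_piMl// invf_le1//.
  by rewrite /pr; elim/big_ind : _ => // [x y x1 y1|k _]; rewrite ?lerDl// -[1]mulr1 ler_pM.
by lra.
Qed.

Lemma robbins_siegmund_level :
  {ae P, forall w, xi 0 w <= c -> (forall n, series (g^~ w) n <= c) ->
     cvgn (series (g^~ w)) ->
     cvgn (xi ^~ w) /\ cvgn (series (theta ^~ w))}.
Proof.
have M0c : (\int[P]_w (M 0 w)%:E < +oo)%E.
  apply: (@le_lt_trans _ _ (\int[P]_w (cst (c + c)%:E w))%E); last first.
    rewrite integral_cst// [X in (_ * X)%E](_ : _ = 1%E) ?mule1 ?ltry//.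
    exact: probability_setT.
  apply: ge0_le_integral => //.
  - by move=> w _; rewrite lee_fin.
  - by apply/measurable_EFinP; exact: (wrt_measurable (sG 0) (@Gm 0) (@mM 0)).
  move=> w _; rewrite lee_fin /M indicE; have [Kw|nKw] := pselect (K 0 w); last first.
    by rewrite memNset//= mul0r addr_ge0.
  rewrite mem_set//= mul1r /pr /Q /sm !big_geq// divr1 subr0 addr0 lerD2r.
  by case: Kw.
have := supermartingale_cvg sG Gm GS M_ge0 mM M_super M0c.
apply: filterS => w cM xc gc cg.
apply: (@robbins_siegmund_path _ (xi^~ w) (theta^~ w) (g ^~ w)) => //.
have Kw n : K n w by split=> //=; exact: gc.
have -> : (fun n => xi n w / pr n w + Q n w) =
    (fun n => M n w) + (series (g^~ w) - cst c).
  apply/funext => n; rewrite !fctE /M indicE mem_set//= mul1r /series /= -/(sm n w).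
  by rewrite /cst; ring.
apply: is_cvgD => //; apply: is_cvgB => //; exact: is_cvg_cst.
Qed.

End level.

(** Almost every path satisfies the bounds of [robbins_siegmund_level] for some
    integer level. *)
Lemma robbins_siegmund : {ae P, forall w, cvgn (series (g^~ w))} ->
  {ae P, forall w, cvgn (xi ^~ w) /\ cvgn (series (theta ^~ w))}.
Proof.
move=> cg; have := ae_forall_count (fun k : nat => robbins_siegmund_level (ler0n R k)).
apply: filterS2 cg => w cg lev.
have gle n : series (g^~ w) n <= limn (series (g^~ w)).
  apply: nondecreasing_cvgn_le => //; apply/nondecreasing_seqP => k.
  by rewrite /series/= big_nat_recr//= lerDl.
have l0 : 0 <= limn (series (g^~ w)).
  by apply: le_trans (gle 0%N); rewrite /series/= big_geq.
set l := limn _ in gle l0.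
have bnd : xi 0 w + l <= (Num.truncn (xi 0 w + l)).+1%:R.
  by apply: ltW; exact: truncnS_gt.
apply: (lev (Num.truncn (xi 0 w + l)).+1) => //.
  by apply: le_trans bnd; rewrite lerDl.
by move=> n; apply: le_trans (gle n) _; apply: le_trans bnd; rewrite lerDr.
Qed.

End robbins_siegmund.

(** * Averaged operators on Hilbert spaces *)
Lemma subrACA {V : zmodType} (x y z t : V) : (x - y) - (z - t) = (x - z) - (y - t).
Proof. by rewrite !opprB addrACA [RHS]addrACA [- z + _]addrC. Qed.

Lemma subrBB {V : zmodType} (x y z : V) : (x - z) - (y - z) = x - y.
Proof. by rewrite opprB addrA subrK. Qed.

Lemma dist_le_continuous {R : realType} {V W : normedModType R} (K : R)
    (f : V -> W) :
  (forall x y, `|f x - f y| <= K * `|x - y|) -> continuous f.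
Proof.
move=> fl x; apply/cvgrPdist_le => e e0.
have K0 : 0 < `|K| + 1 by rewrite ltr_wpDl.
near=> y; apply: le_trans (fl _ _) _.
apply: (@le_trans _ _ ((`|K| + 1) * `|x - y|)).
  by rewrite ler_wpM2r//; apply: le_trans (ler_norm K) _; rewrite lerDl.
rewrite -ler_pdivlMl// mulrC; near: y.
by apply: (@cvgr_dist_le _ _ _ _ _ id) => //; rewrite divr_gt0.
Unshelve. all: by end_near. Qed.

Section inner_algebra.
Context {R : realType} {V : hilbertType R}.
Implicit Types x y z : V.

Lemma innerDl x y z : inner (x + y) z = inner x z + inner y z.
Proof. exact: linearDl. Qed.
Lemma innerDr x y z : inner x (y + z) = inner x y + inner x z.
Proof. exact: linearDr. Qed.
Lemma innerBl x y z : inner (x - y) z = inner x z - inner y z.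
Proof. exact: linearBl. Qed.
Lemma innerBr x y z : inner x (y - z) = inner x y - inner x z.
Proof. exact: linearBr. Qed.
Lemma innerZl (c : R) x y : inner (c *: x) y = c * inner x y.
Proof. exact: linearZl_LR. Qed.
Lemma innerZr (c : R) x y : inner x (c *: y) = c * inner x y.
Proof. exact: linearZr_LR. Qed.

Definition innerE := (innerBl, innerBr, innerDl, innerDr, innerZl, innerZr).

Lemma normD_sqr x y : `|x + y| ^+ 2 = `|x| ^+ 2 + 2 * inner x y + `|y| ^+ 2.
Proof. by rewrite -!inner_normE !innerE (innerC y x); ring. Qed.

Lemma normB_sqr x y : `|x - y| ^+ 2 = `|x| ^+ 2 - 2 * inner x y + `|y| ^+ 2.
Proof. by rewrite -!inner_normE !innerE (innerC y x); ring. Qed.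

Lemma inner_le x y : inner x y <= `|x| * `|y|.
Proof.
have [->|x0] := eqVneq x 0; first by rewrite linear0l normr0 mul0r.
have [->|y0] := eqVneq y 0; first by rewrite linear0r normr0 mulr0.
have xy0 : 0 < `|x| * `|y| by rewrite mulr_gt0// normr_gt0.
have : 0 <= `|(`|y| *: x - `|x| *: y)| ^+ 2 by rewrite sqr_ge0.
rewrite normB_sqr !normrZ !normr_id innerZl innerZr.
rewrite [leRHS](_ : _ = 2 * (`|x| * `|y|) * (`|x| * `|y| - inner x y)); last by ring.
by rewrite pmulr_rge0 ?subr_ge0// mulr_gt0.
Qed.

Lemma norm_inner_le x y : `|inner x y| <= `|x| * `|y|.
Proof.
rewrite ler_norml inner_le andbT lerNl -(normrN x).
by apply: le_trans (inner_le (- x) y); rewrite -(scaleN1r x) innerZl mulN1r.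
Qed.

Lemma norm_convex (t : R) x y : `|(1 - t) *: x + t *: y| ^+ 2 =
  (1 - t) * `|x| ^+ 2 + t * `|y| ^+ 2 - t * (1 - t) * `|x - y| ^+ 2.
Proof. by rewrite -!inner_normE !innerE (innerC y x); ring. Qed.

Lemma inner_cvgl (I : Type) (F : set_system I) (f : I -> V) x y : Filter F ->
  f @ F --> x -> (fun i => inner (f i) y) @ F --> inner x y.
Proof.
move=> FF fx; apply/cvgrPdist_le => e e0.
have d0 : 0 < e / (`|y| + 1) by rewrite divr_gt0// ltr_pwDr.
have /cvgrPdist_le/(_ _ d0) := fx; apply: filterS => i fi.
rewrite -innerBl; apply: le_trans (norm_inner_le _ _) _.
apply: (@le_trans _ _ (e / (`|y| + 1) * `|y|)); first exact: ler_wpM2r.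
by rewrite -mulrA ler_piMr ?(ltW e0)// ler_pdivrMl ?ltr_pwDr// mulr1 lerDl.
Qed.

Lemma inner_continuous y : continuous (inner^~ y : V -> R).
Proof. by move=> x; exact: inner_cvgl. Qed.

End inner_algebra.

Section averaged.
Context {R : realType} {V : hilbertType R}.
Implicit Types (T : V -> V) (x y z : V).

Lemma nonexpansiveP T : nonexpansive T -> forall x y, `|T x - T y| <= `|x - y|.
Proof. by move=> nT x y; have := nT (x, y) (conj I I); rewrite /= mul1r. Qed.

(** Expand the square of a convex combination: the correction term
    [alpha * (1 - alpha) * |(x - y) - (Q x - Q y)|^2] is the residual term,
    because [x - T x] is [alpha] times [x - Q x]. *)
Lemma averaged_le (alpha : R) T : 0 < alpha -> averaged alpha T ->
  forall x y, `|T x - T y| ^+ 2 +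
    (1 - alpha) / alpha * `|(x - T x) - (y - T y)| ^+ 2 <= `|x - y| ^+ 2.
Proof.
move=> a0 [nT [Q /nonexpansiveP nQ TE]] x y.
have -> : T x - T y = (1 - alpha) *: (x - y) + alpha *: (Q x - Q y).
  by rewrite !TE !scalerBr opprD addrACA.
have -> : (x - T x) - (y - T y) = alpha *: ((x - y) - (Q x - Q y)).
  have idT z : z - T z = alpha *: (z - Q z).
    by rewrite TE scalerBl scale1r scalerBr opprD addrA subKr.
  rewrite !idT -scalerBr !opprB; congr (_ *: _).
  by rewrite addrACA [RHS]addrACA [- Q x - y]addrC.
rewrite norm_convex normrZ gtr0_norm// exprMn.
have : `|Q x - Q y| ^+ 2 <= `|x - y| ^+ 2 by rewrite ler_sqr ?nnegrE.
set A := `|x - y| ^+ 2; set B := `|Q x - Q y| ^+ 2; set C := `|_| ^+ 2.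
move=> BA; have -> : (1 - alpha) / alpha * (alpha ^+ 2 * C) = alpha * (1 - alpha) * C.
  by field; rewrite gt_eqF.
by nra.
Qed.

End averaged.

(** * Weak compactness of bounded sequences *)
Section riesz.
Context {R : realType} {V : hilbertType R}.

(** The representing vector minimizes [|v|^2 - 2 l v].  Minimizing sequences are
    Cauchy by the parallelogram law, and the first-order condition at the
    minimizer is the claim. *)
Lemma riesz (l : V -> R) (B : R) :
  (forall c x y, l (c *: x + y) = c * l x + l y) ->
  (forall x, `|l x| <= B * `|x|) ->
  exists w, forall v, l v = inner w v.
Proof.
move=> lin lB.
pose J v : R := `|v| ^+ 2 - 2 * l v.
pose E : set R := range J.
have lbE : lbound E (- B ^+ 2).
  move=> _ [v _ <-]; have := le_trans (ler_norm _) (lB v).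
  have : 0 <= (`|v| - B) ^+ 2 by exact: sqr_ge0.
  by rewrite /J; set n := `|v| => h1 h2; nra.
have infE : has_inf E by split; [exists (J 0), 0|exists (- B ^+ 2)].
have infJ v : inf E <= J v.
  by apply: inf_lbound; [exact: infE.2|exists v].
have ex n : exists v, J v < inf E + n.+1%:R^-1.
  have n0 : 0 < n.+1%:R^-1 :> R by rewrite invr_gt0.
  by have [_ [v _ <-] h] := inf_adherent n0 infE; exists v.
have [v vP] := choice ex.
(* the parallelogram law, with the squares replaced by J *)
have par x y : `|x - y| ^+ 2 = 2 * J x + 2 * J y - 4 * J (2^-1 *: x + 2^-1 *: y).
  rewrite /J lin -[2^-1 *: y]addr0 lin.
  have l0 : l 0 = 0.
    by have := lin 1 0 0; rewrite scaler0 addr0 mul1r => /eqP; rewrite -subr_eq0 opprD addrA subrr sub0r oppr_eq0 => /eqP.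
  by rewrite l0 !addr0 -!inner_normE !innerE (innerC y x); field.
have aux (i j1 j2 j3 a b : R) : j1 < i + a -> j2 < i + b -> i <= j3 -> a <= b ->
    2 * j2 + 2 * j1 - 4 * j3 <= 4 * b by lra.
have dist N n : (N <= n)%N -> `|v N - v n| ^+ 2 <= 4 * N.+1%:R^-1.
  move=> Nn; rewrite par.
  have : n.+1%:R^-1 <= N.+1%:R^-1 :> R by rewrite lef_pV2 ?posrE// ler_nat.
  have := infJ (2^-1 *: v N + 2^-1 *: v n); have := vP N; have := vP n.
  exact: aux.
have cv : cvg (v n @[n --> \oo]).
  apply: cauchy_cvg; apply/(@cauchy_exP R) => e e0.
  have [N Ne] : exists N : nat, 4 * N.+1%:R^-1 < e ^+ 2.
    exists (Num.truncn (4 / e ^+ 2)).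
    rewrite ltr_pdivrMr// mulrC -ltr_pdivrMr ?exprn_gt0//.
    exact: truncnS_gt.
  exists (v N); exists N => // n /= Nn; rewrite -ball_normE /=.
  rewrite -(@ltr_pXn2r _ 2)// ?nnegrE ?(ltW e0)//.
  exact: le_lt_trans (dist _ _ Nn) Ne.
set w := lim (v n @[n --> \oo]) in cv.
exists w => z.
(* J (w + t z) >= J w, obtained as a limit of the approximate minimality of v n *)
have key t : 0 <= 2 * t * (inner w z - l z) + t ^+ 2 * `|z| ^+ 2.
  have lim1 : (fun n => 2 * t * (inner (v n) z - l z) + t ^+ 2 * `|z| ^+ 2 + n.+1%:R^-1)
     @ \oo --> 2 * t * (inner w z - l z) + t ^+ 2 * `|z| ^+ 2 + 0.
    apply: cvgD; last exact: cvg_harmonic.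
    apply: cvgD; last exact: cvg_cst.
    apply: cvgM; first exact: cvg_cst.
    by apply: cvgB; [exact: inner_cvgl|exact: cvg_cst].
  rewrite -[leRHS]addr0; apply: (cvgr_to_ge lim1); apply: nearW => n.
  have := infJ (t *: z + v n); have := vP n; rewrite /J lin normD_sqr innerZl normrZ exprMn.
  rewrite real_normK ?num_real// (innerC z).
  move=> /ltW h1 h2; have := lerD h2 h1; rewrite -subr_ge0 => /le_trans; apply.
  by rewrite le_eqVlt; apply/orP; left; apply/eqP; ring.
set D := inner w z - l z in key; set N := `|z| ^+ 2 in key.
have N0 : 0 <= N by exact: sqr_ge0.
(* t = - D / (N + 1) makes the quadratic polynomial negative unless D = 0 *)
have D0 : D = 0.
  have := key (- D / (N + 1)).
  have -> : 2 * (- D / (N + 1)) * D + (- D / (N + 1)) ^+ 2 * N =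
      - (D ^+ 2 * (N + 2)) / (N + 1) ^+ 2 by field; rewrite gt_eqF// ltr_wpDl.
  rewrite pmulr_lge0 ?invr_gt0 ?exprn_gt0 ?ltr_wpDl// oppr_ge0.
  rewrite pmulr_lle0 ?ltr_wpDl// => D2; apply/eqP; rewrite -sqrf_eq0.
  by rewrite eq_le D2 sqr_ge0.
by apply/eqP; rewrite eq_sym -subr_eq0 -/D D0.
Qed.

End riesz.

Lemma homo_ltn_ge (k : nat -> nat) : {homo k : i j / (i < j)%N} -> forall n, (n <= k n)%N.
Proof. by move=> kh; elim=> // n ih; apply: leq_ltn_trans ih _; exact: kh. Qed.

Lemma subseq_cvg {T : topologicalType} (u : nat -> T) (l : T) (k : nat -> nat) :
  {homo k : i j / (i < j)%N} -> u @ \oo --> l -> u (k n) @[n --> \oo] --> l.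
Proof.
move=> kh ul A /ul[N _ NA]; exists N => // n /= Nn; apply: NA => /=.
exact: leq_trans Nn (homo_ltn_ge kh n).
Qed.

Lemma extraction (A : nat -> nat -> Prop) :
  (forall n N, exists2 k, (N <= k)%N & A n k) ->
  exists2 k : nat -> nat, {homo k : i j / (i < j)%N} & forall n, A n (k n).
Proof.
move=> ex.
have /choice[f fP] : forall nN : nat * nat, exists k, (nN.2 <= k)%N /\ A nN.1 k.
  by move=> [n N]; have [k] := ex n N; exists k.
pose fix k n := if n is n'.+1 then f (n, (k n').+1) else f (0, 0)%N.
exists k; last by case=> [|n]; exact: (fP (_, _)).2.
by apply: (homo_ltn ltn_trans) => n; exact: (fP (_, _)).1.
Qed.

Definition approximable {R : realType} {V : normedModType R} (A : set V)
    (s : nat -> V) :=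
  forall v e, A v -> 0 < e -> exists j, `|v - s j| < e.

(** Otherwise the complement of a neighbourhood of a cluster point would belong
    to the ultrafilter. *)
Lemma ultra_bounded_cvg {R : realType} (U : set_system nat) (f : nat -> R) (C : R) :
  UltraFilter U -> (forall n, `|f n| <= C) -> exists p : R, f @ U --> p.
Proof.
move=> UU fC; have fK : (f @ U) `[- C, C]%classic.
  by apply: (@filterE _ U) => n; rewrite /= in_itv/= -ler_norml.
have [p [_ clp]] := @segment_compact R (- C) C _ (fmap_proper_filter f _) fK.
exists p; apply/cvgrPdist_lt => e e0.
have [//|nU] := in_ultra_setVsetC [set n | `|p - f n| < e] UU.
have [r [[n nn nr] pr]] : (f @` (~` [set n | `|p - f n| < e])) `&` ball p e !=set0.
  apply: clp; last exact: nbhsx_ballx.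
  by apply: (@filterS _ U _ _ _ _ nU) => n nn; exists n.
by case: nn => /=; rewrite nr.
Qed.

Section weak_compactness.
Context {R : realType} {V : hilbertType R}.
Implicit Types (u : nat -> V).

Lemma weakly_cvg_unique u x y : weakly_cvg u x -> weakly_cvg u y -> x = y.
Proof.
move=> ux uy; apply/eqP; rewrite -subr_eq0 -normr_eq0 -sqrf_eq0 -inner_normE.
rewrite innerBl subr_eq0; apply/eqP.
exact: (cvg_unique _ (ux (x - y)) (uy (x - y))).
Qed.

Lemma weakly_cvg_subseq u x (k : nat -> nat) : {homo k : i j / (i < j)%N} ->
  weakly_cvg u x -> weakly_cvg (u \o k) x.
Proof. by move=> kh ux v; exact: (subseq_cvg kh (ux v)). Qed.

Lemma cvg_weakly_cvg u x : u @ \oo --> x -> weakly_cvg u x.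
Proof. by move=> ux v; exact: inner_cvgl. Qed.

(** The functionals [inner (u n)] are uniformly Lipschitz, so that their
    convergence need only be tested on a dense sequence. *)
Lemma weakly_cvg_dense u x (B : R) (s : nat -> V) : approximable setT s ->
  (forall n, `|u n| <= B) ->
  (forall j, inner (u n) (s j) @[n --> \oo] --> inner x (s j)) ->
  weakly_cvg u x.
Proof.
move=> sd uB us v; apply/cvgrPdist_le => e e0.
have B0 : 0 <= B by apply: le_trans (uB 0%N).
have Bx : 0 < B + `|x| + 1 by rewrite ltr_wpDl// addr_ge0.
have d0 : 0 < e / 2 / (B + `|x| + 1) by rewrite !divr_gt0.
have [j vj] := sd v _ I d0.
have e20 : 0 < e / 2 by rewrite divr_gt0.
have /cvgrPdist_le/(_ _ e20) := us j; apply: filterS => n xn.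
rewrite -innerBl (_ : v = s j + (v - s j)); last by rewrite addrC subrK.
rewrite innerDr [leRHS]splitr (le_trans (ler_normD _ _))// lerD//.
  by rewrite innerBl.
apply: le_trans (norm_inner_le _ _) _.
apply: (@le_trans _ _ ((B + `|x| + 1) * (e / 2 / (B + `|x| + 1)))); last first.
  by rewrite mulrC divfK// gt_eqF.
apply: ler_pM => //; last exact: ltW.
apply: le_trans (ler_normB _ _) _; rewrite addrC -addrA lerD//.
by rewrite lerDl.
Qed.

(** Along an ultrafilter all the scalar sequences [inner (u n) v] converge
    simultaneously; the limit is a bounded linear functional of [v], represented
    by some [x].  Separability turns this into a subsequence: its [n]-th term is
    chosen among the indices that are good for the first vectors of the dense
    sequence, which belong to the ultrafilter. *)
Lemma bounded_weak_cluster u (B : R) (s : nat -> V) : approximable setT s ->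
  (forall n, `|u n| <= B) -> weak_cluster u !=set0.
Proof.
move=> sd uB.
have [U [UU ooU]] := @ultraFilterLemma nat \oo _.
have ubv v n : `|inner (u n) v| <= B * `|v|.
  by apply: le_trans (norm_inner_le _ _) _; rewrite ler_wpM2r.
have /choice[l lP] : forall v, exists p : R, inner (u n) v @[n --> U] --> p.
  by move=> v; exact: ultra_bounded_cvg (ubv v).
have [x xP] : exists x, forall v, l v = inner x v.
  apply: (@riesz _ _ _ B) => [c v w|v].
    apply: (cvg_unique _ (lP _)) => //.
    have -> : (fun n => inner (u n) (c *: v + w)) =
        (fun n => c * inner (u n) v + inner (u n) w).
      by apply/funext => n; rewrite innerDr innerZr.
    by apply: cvgD => //; apply: cvgM => //; exact: cvg_cst.
  have /cvg_norm h := lP v.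
  by apply: (cvgr_to_le h); apply: nearW => n; exact: ubv.
exists x.
have exA n N : exists2 k, (N <= k)%N & forall j : 'I_n.+1,
    `|inner x (s j) - inner (u k) (s j)| < n.+1%:R^-1.
  have UA : \forall k \near U, forall j : 'I_n.+1,
      `|inner x (s j) - inner (u k) (s j)| < n.+1%:R^-1.
    apply: filter_forall => j.
    have n0 : 0 < n.+1%:R^-1 :> R by rewrite invr_gt0.
    by have := lP (s j); rewrite xP => /cvgrPdist_lt/(_ _ n0).
  have UN : U [set k | (N <= k)%N] by apply: ooU; exists N.
  by have [k [kN kA]] := filter_ex (filterI UN UA); exists k.
have [k kh kP] := extraction exA.
exists k => //; apply: (weakly_cvg_dense sd) => [n|j]; first exact: uB.
apply/cvgrPdist_le => e e0; near=> n.
have jn : (j < n.+1)%N by rewrite ltnS; near: n; exact: nbhs_infty_ge.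
apply: le_trans (ltW (kP n (Ordinal jn))) _.
by apply/ltW; near: n; exact: (near_infty_natSinv_lt (PosNum e0)).
Unshelve. all: by end_near. Qed.

End weak_compactness.

(** * Weak measurability and separability *)
Section borel_measurability.
Context {R : realType} {V : hilbertType R}.

Lemma continuous_borel_measurable (f : V -> R) : continuous f ->
  measurable_fun (setT : set (borel V)) f.
Proof.
move=> /continuousP cf; apply: (measurability _ (RGenOpens.measurableE R)).
move=> _ [_ [a [b ->] <-]]; rewrite setTI; apply: sub_sigma_algebra.
exact/cf/interval_open.
Qed.

(** A closed ball is a countable intersection of half-spaces. *)
Lemma norm_le_inner_dense (s : nat -> V) (x : V) (r : R) :
  approximable setT s -> 0 <= r ->
  `|x| <= r <-> forall j, inner x (s j) <= r * `|s j|.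
Proof.
move=> sd r0; split=> [xr j|h].
  by apply: le_trans (inner_le _ _) _; exact: ler_wpM2r.
have xx : `|x| ^+ 2 <= r * `|x|.
  apply/ler_addgt0Pr => e e0.
  have d0 : 0 < e / (`|x| + r + 1) by rewrite divr_gt0// ltr_wpDl// addr_ge0.
  have [j xj] := sd x _ I d0.
  rewrite -inner_normE (_ : inner x x = inner x (s j) + inner x (x - s j)); last first.
    by rewrite innerBr addrC subrK.
  have h1 : inner x (x - s j) <= `|x| * (e / (`|x| + r + 1)).
    by apply: le_trans (inner_le _ _) _; rewrite ler_wpM2l// ltW.
  have h2 : r * `|s j| <= r * `|x| + r * (e / (`|x| + r + 1)).
    rewrite -mulrDr ler_wpM2l//.
    rewrite (_ : s j = x - (x - s j)); last by rewrite subKr.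
    by apply: le_trans (ler_normB _ _) _; rewrite lerD2l ltW.
  apply: le_trans (lerD (le_trans (h j) h2) h1) _.
  rewrite -addrA lerD2l -mulrDl mulrCA ler_piMr ?(ltW e0)//.
  by rewrite ler_pdivrMr ?mul1r ?ltr_wpDl ?addr_ge0// addrC lerDl.
have [->|x0] := eqVneq x 0; first by rewrite normr0.
by rewrite -(ler_pM2r (_ : 0 < `|x|)) ?normr_gt0// -expr2.
Qed.

(** Pettis' theorem: an open set is a countable union of closed balls with
    centres in the dense sequence, and closed balls are countable intersections
    of half-spaces. *)
Lemma weakly_measurable {d} {T : measurableType d} (X : T -> V) (s : nat -> V) :
  approximable setT s ->
  (forall v, measurable_fun setT (fun w => inner (X w) v)) ->
  measurable_fun setT (X : T -> borel V).
Proof.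
move=> sd mX; have mE : @measurable _ (borel V) = <<s @open V >> by [].
apply: (@measurability _ _ T (borel V) setT X (@open V) mE) => _ [U oU <-]; rewrite setTI.
pose B (j q : nat) : set V := [set v | `|v - s j| <= q.+1%:R^-1].
pose D : set (nat * nat) := [set jq | B jq.1 jq.2 `<=` U].
have -> : X @^-1` U = \bigcup_(jq in D) (X @^-1` B jq.1 jq.2).
  apply/seteqP; split=> [w Uw|w [[j q] BU]]; last by move/BU.
  have /nbhs_ballP[e /= e0 eU] := open_nbhs_nbhs (conj oU Uw).
  have [q qe] : exists q : nat, q.+1%:R^-1 < e / 2.
    exists (Num.truncn (e / 2)^-1).
    by rewrite invf_plt ?posrE ?divr_gt0//; exact: truncnS_gt.
  have q0 : 0 < q.+1%:R^-1 :> R by rewrite invr_gt0.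
  have [j xj] := sd (X w) _ I q0.
  exists (j, q); last exact: ltW.
  move=> v /= vj; apply: eU; rewrite -ball_normE /=.
  rewrite (_ : X w - v = (X w - s j) - (v - s j)); last by rewrite opprB addrA subrK.
  rewrite (splitr e) (le_lt_trans (ler_normB _ _))// ltrD//; first exact: lt_trans qe.
  exact: le_lt_trans qe.
rewrite bigcup_mkcond; apply: countable_bigcupT_measurable => [|[j q]].
  exact: countableP.
case: ifP => // _ /=.
have q0 : 0 <= q.+1%:R^-1 :> R by rewrite invr_ge0.
have -> : X @^-1` B j q =
    \bigcap_l [set w | inner (X w) (s l) - inner (s j) (s l) <= q.+1%:R^-1 * `|s l|].
  apply/seteqP; split=> w /=.
    move/(norm_le_inner_dense _ sd q0) => h l _ /=.
    by rewrite -innerBl.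
  move=> h; apply/(norm_le_inner_dense _ sd q0) => l.
  by rewrite innerBl; exact: h.
apply: bigcapT_measurable => // l.
pose f w := inner (X w) (s l) - inner (s j) (s l).
have mf : measurable_fun setT f by apply: measurable_funB.
have := mf measurableT _ (measurable_itv `]-oo, (q.+1%:R^-1 * `|s l|)]).
by rewrite setTI.
Qed.

End borel_measurability.

Section separability.
Context {R : realType}.

Lemma separable_approximable (V : normedModType R) :
  separable_space V -> exists s : nat -> V, approximable setT s.
Proof.
move=> [S cS dS].
have S0 : S !=set0.
  by have [v [_ Sv]] := dS setT (ex_intro _ 0 I) openT; exists v.
have /pfcard_geP[S00|[s]] := cS; first by move: S0; rewrite S00 => -[].
exists s => v e _ e0.
have ov : open (ball v e) by exact: ball_open.
have [x [vx Sx]] := dS (ball v e) (ex_intro _ v (ballxx v e0)) ov.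
have [j _ sj] : (s @` setT) x by have := @surj _ _ _ _ s; apply.
by exists j; rewrite sj; move: vx; rewrite -ball_normE.
Qed.

(** For each ball with centre [s j] and radius [1 / (q + 1)] that meets [A],
    choose a point of [A] in it. *)
Lemma approximable_subset {V : normedModType R} (A : set V) (s : nat -> V) z0 :
  A z0 -> approximable setT s ->
  exists2 t : nat -> V, approximable A t & forall j, A (t j).
Proof.
move=> Az0 sd.
have /choice[f fP] : forall jq : nat * nat, exists v, A v /\
    ((exists2 a, A a & `|a - s jq.1| < jq.2.+1%:R^-1) ->
      `|v - s jq.1| < jq.2.+1%:R^-1).
  move=> [j q] /=.
  have [[a Aa aj]|na] := pselect (exists2 a, A a & `|a - s j| < q.+1%:R^-1).
    by exists a.
  by exists z0.
exists (fun n => if unpickle n is Some jq then f jq else z0).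
  move=> v e Av e0.
  have [q qe] : exists q : nat, q.+1%:R^-1 < e / 2.
    exists (Num.truncn (e / 2)^-1).
    by rewrite invf_plt ?posrE ?divr_gt0//; exact: truncnS_gt.
  have q0 : 0 < q.+1%:R^-1 :> R by rewrite invr_gt0.
  have [j vj] := sd v _ I q0.
  exists (pickle (j, q)); rewrite pickleK.
  have /= fj := (fP (j, q)).2 (ex_intro2 _ _ v Av vj).
  rewrite (_ : v - f (j, q) = (v - s j) - (f (j, q) - s j)); last first.
    by rewrite opprB addrA subrK.
  by rewrite (splitr e) (le_lt_trans (ler_normB _ _))// ltrD//; exact: lt_trans qe.
by move=> n; case: unpickle => [jq|//]; exact: (fP jq).1.
Qed.

Lemma hsum_approximable {I : finType} (H : I -> hilbertType R) :
  (forall i, separable_space (H i)) -> exists s : nat -> hsum H, approximable setT s.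
Proof.
move=> Hsep.
have sP i : exists s : nat -> H i, approximable setT s.
  exact: (separable_approximable (Hsep i)).
pose s i := projT1 (cid (sP i)).
have sd i : approximable setT (s i) by rewrite /s; case: cid.
pose f (k : {ffun I -> nat}) : hsum H := fun i => s i (k i).
exists (fun n => if unpickle n is Some k then f k else 0) => v e _ e0.
have d0 : 0 < e / #|I|.+1%:R by rewrite divr_gt0.
have kP i : exists k, `|v i - s i k| < e / #|I|.+1%:R by exact: sd.
pose k := [ffun i => projT1 (cid (kP i))].
exists (pickle k); rewrite pickleK.
apply: le_lt_trans (hsum_norm_le _) _.
apply: (@le_lt_trans _ _ (\sum_(i : I) e / #|I|.+1%:R)).
  apply: ler_sum => i _; have -> : (v - f k) i = v i - s i (k i) by [].
  by rewrite ffunE; case: cid => j /= /ltW.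
rewrite sumr_const -[ltLHS]mulr_natr -mulrA gtr_pMr//.
by rewrite mulrC ltr_pdivrMr// mul1r ltr_nat.
Qed.

End separability.

(** * Weighted squared distances and Opial's argument *)
Section weighted_square.
Context {R : realType} {I : finType} {H : I -> hilbertType R}.
Variable omega : I -> R.
Hypothesis omega_gt0 : forall i, 0 < omega i.
Implicit Types (x y z v : hsum H) (u : nat -> hsum H).

Definition wsq x : R := \sum_i omega i * `|x i| ^+ 2.

Definition wscale x : hsum H := fun i => omega i *: x i.

Lemma wsq_ge0 x : 0 <= wsq x.
Proof. by apply: sumr_ge0 => i _; rewrite mulr_ge0 ?sqr_ge0// ltW. Qed.

Lemma wsqB x y : wsq (x - y) = wsq x - 2 * inner x (wscale y) + wsq y.
Proof.
rewrite hsum_inner_sum /wsq mulr_sumr -sumrB -big_split/=.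
apply: eq_bigr => i _; rewrite (_ : (x - y) i = x i - y i)// normB_sqr.
by rewrite /wscale innerZr; ring.
Qed.

Lemma inner_wscale x : inner x (wscale x) = wsq x.
Proof.
rewrite hsum_inner_sum; apply: eq_bigr => i _.
by rewrite /wscale innerZr inner_normE.
Qed.

Lemma wscaleB x y : wscale (x - y) = wscale x - wscale y.
Proof.
apply: functional_extensionality_dep => i.
by rewrite /wscale (_ : (x - y) i = x i - y i)// scalerBr.
Qed.

Lemma norm_wscale_le x : `|wscale x| <= (\sum_i omega i) * `|x|.
Proof.
apply: le_trans (hsum_norm_le _) _; rewrite mulr_suml; apply: ler_sum => i _.
rewrite normrZ gtr0_norm// ler_wpM2l ?(ltW (omega_gt0 i))//.
exact: hsum_coord_le.
Qed.

Lemma norm_le_wsq x : `|x| ^+ 2 <= (\sum_i (omega i)^-1) * wsq x.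
Proof.
rewrite -hsum_innerE /hsum_inner mulr_suml; apply: ler_sum => i _.
rewrite inner_normE ler_pdivlMl//.
by rewrite /wsq (bigD1 i)//= lerDl sumr_ge0// => j _; rewrite mulr_ge0 ?sqr_ge0// ltW.
Qed.

Lemma hsum_coord_continuous i : continuous (fun y : hsum H => y i : H i).
Proof.
apply: (@dist_le_continuous _ (hsum H) (H i) 1) => x y; rewrite mul1r.
exact: (hsum_coord_le (x - y)).
Qed.

Lemma wsq_continuous : continuous (wsq : hsum H -> R).
Proof.
rewrite /wsq; apply: continuous_big => [|i _ x]; first exact: add_continuous.
have hn : (fun y : hsum H => `|y i|) @ x --> `|x i|.
  exact: cvg_norm (@hsum_coord_continuous i x).
exact: (cvgM (cvg_cst (omega i)) (cvgM hn hn)).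
Qed.

Lemma wsqB_continuous z : continuous (fun x => wsq (x - z)).
Proof.
move=> x; apply: (@continuous_comp _ _ _ (fun x => x - z) wsq).
  apply: (@dist_le_continuous _ (hsum H) (hsum H) 1) => v y.
  by rewrite opprB addrA subrK mul1r.
exact: wsq_continuous.
Qed.

Lemma wsq_bounded u z : cvgn (fun n => wsq (u n - z)) ->
  exists B, forall n, `|u n| <= B.
Proof.
move=> /cvg_seq_bounded [M [_ MM]].
pose K := (\sum_i (omega i)^-1) * (M + 1).
exists (`|z| + K + 1) => n.
have K0 : 0 <= \sum_i (omega i)^-1 by apply: sumr_ge0 => i _; rewrite invr_ge0 ltW.
have /= h := MM (M + 1) (ltr_pwDr ltr01 (lexx _)) n Logic.I.
have h1 : `|u n - z| ^+ 2 <= K.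
  apply: le_trans (norm_le_wsq _) _; rewrite ler_wpM2l//.
  exact: le_trans (ler_norm _) h.
have h2 : `|u n - z| <= K + 1.
  have [l1|l1] := leP (`|u n - z|) 1.
    by apply: le_trans l1 _; rewrite lerDr; apply: le_trans h1; exact: sqr_ge0.
  apply: le_trans (_ : K <= _); last by rewrite lerDl.
  by apply: le_trans h1; rewrite expr2 ler_peMr// ltW.
rewrite (_ : u n = z + (u n - z)); last by rewrite addrC subrK.
by apply: le_trans (ler_normD _ _) _; rewrite -addrA lerD2l.
Qed.

(** Changing the reference point from [s j] to [z] changes the weighted square
    by a constant and by a scalar product of [u n] with a vector of norm at most
    proportional to [|z - s j|].  As [u] is bounded, the sequence for [z] is a
    uniform limit, up to constants, of convergent ones, hence Cauchy. *)
Lemma wsq_cvg_approximable u (B : R) (A : set (hsum H)) (s : nat -> hsum H) :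
  (forall n, `|u n| <= B) -> approximable A s ->
  (forall j, cvgn (fun n => wsq (u n - s j))) ->
  forall z, A z -> cvgn (fun n => wsq (u n - z)).
Proof.
move=> uB sA us z Az; apply: cauchy_cvg; apply/(@cauchy_exP R) => e e0.
pose W := \sum_i omega i.
have W0 : 0 <= W by apply: sumr_ge0 => i _; rewrite ltW.
have B0 : 0 <= B by apply: le_trans (uB 0%N).
pose C := 4 * (B * W) + 1.
have C0 : 0 < C by rewrite ltr_wpDl// mulr_ge0// mulr_ge0.
have d0 : 0 < e / 2 / C by rewrite !divr_gt0.
have [j zj] := sA z _ Az d0.
have /cvg_ex[l /cvgrPdist_lt/(_ (e / 4))] := us j.
rewrite divr_gt0// => /(_ isT)[N _ lN].
exists (wsq (u N - z)); exists N => // n /= Nn; rewrite -ball_normE /=.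
have split k : wsq (u k - z) = wsq (u k - s j)
    - 2 * inner (u k) (wscale (z - s j)) + (wsq z - wsq (s j)).
  by rewrite !wsqB wscaleB innerBr; ring.
rewrite !split.
set p := wsq (u N - s j); set q := wsq (u n - s j).
set a := inner (u N) _; set b := inner (u n) _.
have ab k : `|inner (u k) (wscale (z - s j))| <= B * W * (e / 2 / C).
  apply: le_trans (norm_inner_le _ _) _; rewrite -mulrA.
  apply: ler_pM => //; apply: le_trans (norm_wscale_le _) _.
  by rewrite ler_wpM2l// ltW.
have BWe : 4 * (B * W * (e / 2 / C)) < e / 2.
  rewrite (_ : 4 * (B * W * (e / 2 / C)) = (4 * (B * W)) / C * (e / 2)); last first.
    by field; rewrite gt_eqF.
  by rewrite gtr_pMl ?divr_gt0// ltr_pdivrMr// mul1r ltrDl.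
have := lN N (leqnn N); have := lN n Nn; rewrite -/p -/q /=.
have := ab N; have := ab n; rewrite -/a -/b.
rewrite !ler_norml !ltr_norml => /andP[b1 b2] /andP[a1 a2] /andP[q1 q2] /andP[p1 p2].
by apply/andP; split; lra.
Qed.

(** If [x] and [y] are weak cluster points, the difference of the weighted
    squared distances from [u n] to them is affine in
    [inner (u n) (wscale (x - y))], which therefore converges; comparing its
    values at [x] and [y] gives [wsq (x - y) = 0].  Every subsequence has a weak
    cluster point, so that the whole sequence converges to the only one. *)
Lemma opial u (B : R) (A : set (hsum H)) (s : nat -> hsum H) :
  approximable setT s -> (forall n, `|u n| <= B) -> weak_cluster u `<=` A ->
  (forall z, A z -> cvgn (fun n => wsq (u n - z))) ->
  exists2 x, A x & weakly_cvg u x.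
Proof.
move=> sd uB uA cA.
have [x ux] := bounded_weak_cluster sd uB.
have Ax := uA _ ux.
have uniq y : weak_cluster u y -> y = x.
  move=> uy; have Ay := uA _ uy.
  have : cvgn (fun n => inner (u n) (wscale (x - y))).
    have -> : (fun n => inner (u n) (wscale (x - y))) =
        (fun n => 2^-1 * ((wsq (u n - y) - wsq (u n - x)) + (wsq x - wsq y))).
      by apply/funext => n; rewrite !wsqB wscaleB innerBr; field.
    apply: is_cvgM; first exact: is_cvg_cst.
    apply: is_cvgD; last exact: is_cvg_cst.
    by apply: is_cvgB; exact: cA.
  move=> /cvg_ex[l ul].
  have lim v : weak_cluster u v -> inner v (wscale (x - y)) = l.
    move=> [k kh kv].
    exact: (cvg_unique _ (kv (wscale (x - y))) (subseq_cvg kh ul)).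
  have : wsq (x - y) = 0.
    by rewrite -inner_wscale innerBl !lim ?subrr.
  move=> w0; apply/esym/eqP; rewrite -subr_eq0 -normr_eq0 -sqrf_eq0.
  rewrite eq_le sqr_ge0 andbT; apply: le_trans (norm_le_wsq _) _.
  by rewrite w0 mulr0.
exists x => // v; apply: contrapT => ncv.
have [e e0 ne] : exists2 e : R, 0 < e &
    forall n N : nat, exists2 k, (N <= k)%N & e < `|inner x v - inner (u k) v|.
  apply: contrapT => /forall2NP h; apply: ncv; apply/cvgrPdist_le => e e0.
  have [//|/existsNP[n /existsNP[N hN]]] := h e.
  exists N => // k /= Nk; rewrite leNgt; apply/negP => ek; apply: hN.
  by exists k.
have [k kh kP] := extraction ne.
have [y [k' kh' ky]] := bounded_weak_cluster sd (fun n => uB (k n)).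
have yx : y = x.
  by apply: uniq; exists (k \o k') => // i j ij; apply: kh; exact: kh'.
have /cvgrPdist_le/(_ _ e0)[N _ /(_ N (leqnn N))] := ky v.
by rewrite yx /= leNgt kP.
Qed.

(** The strong cluster point is also a weak one, hence it is [x]; thus the
    convergent sequence [wsq (u n - x)] has 0 as a cluster point. *)
Lemma weak_to_strong u x : weakly_cvg u x -> cvgn (fun n => wsq (u n - x)) ->
  strong_cluster u !=set0 -> u @ \oo --> x.
Proof.
move=> ux /cvg_ex[l ul] [z [k kh kz]].
have zx : z = x.
  by apply: (weakly_cvg_unique (cvg_weakly_cvg kz)); exact: weakly_cvg_subseq.
have l0 : l = 0.
  apply: (cvg_unique _ (subseq_cvg kh ul)) => //.
  have -> : 0 = wsq (x - x).
    by rewrite subrr /wsq big1// => i _; rewrite normr0 expr0n mulr0.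
  rewrite zx in kz.
  exact: (cvg_comp _ _ kz (@wsqB_continuous x x)).
pose K := \sum_i (omega i)^-1 + 1.
have K0 : 0 < K by rewrite ltr_wpDl// sumr_ge0// => i _; rewrite invr_ge0 ltW.
apply/cvgrPdist_lt => e e0.
have d0 : 0 < e ^+ 2 / K by rewrite divr_gt0// exprn_gt0.
move: ul; rewrite l0 => /cvgrPdist_lt/(_ _ d0); apply: filterS => n.
rewrite sub0r normrN ger0_norm ?wsq_ge0// => h.
rewrite distrC -(@ltr_pXn2r _ 2)// ?nnegrE ?(ltW e0)//.
apply: le_lt_trans (norm_le_wsq _) _.
rewrite ltr_pdivlMr// mulrC in h; apply: le_lt_trans h.
by rewrite ler_wpM2r ?wsq_ge0// lerDl.
Qed.

End weighted_square.

(** * Conditional domination *)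
Section conditional_domination.
Context {d : measure_display} {Omega : measurableType d} {R : realType}.
Variable P : probability Omega R.
Variable G : set (set Omega).
Hypothesis sG : sigma_algebra setT G.
Hypothesis Gm : G `<=` measurable.

Local Notation OG := (g_sigma_algebraType G).

Implicit Types f g : Omega -> R.

(** [E(f | G) <= E(g | G)], expressed without conditional expectations. *)
Definition cond_le f g :=
  [/\ measurable_fun setT f, measurable_fun setT g,
      (forall w, 0 <= f w), (forall w, 0 <= g w) &
      forall A, G A ->
        (\int[P]_(w in A) (f w)%:E <= \int[P]_(w in A) (g w)%:E)%E].

Lemma cond_le_refl f : measurable_fun setT f -> (forall w, 0 <= f w) -> cond_le f f.
Proof. by split. Qed.

Lemma cond_leD (f1 g1 f2 g2 : Omega -> R) : cond_le f1 g1 -> cond_le f2 g2 ->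
  cond_le (fun w => f1 w + f2 w) (fun w => g1 w + g2 w).
Proof.
move=> [mf1 mg1 f10 g10 le1] [mf2 mg2 f20 g20 le2]; split.
- exact: measurable_funD.
- exact: measurable_funD.
- by move=> w; exact: addr_ge0.
- by move=> w; exact: addr_ge0.
move=> A GA.
have intD (h k : Omega -> R) : measurable_fun setT h -> measurable_fun setT k ->
    (forall w, 0 <= h w) -> (forall w, 0 <= k w) ->
    (\int[P]_(w in A) (h w + k w)%:E =
     \int[P]_(w in A) (h w)%:E + \int[P]_(w in A) (k w)%:E)%E.
  move=> mh mk h0 k0; under eq_integral do rewrite EFinD.
  rewrite ge0_integralD//.
  - exact: Gm.
  - by move=> w _; rewrite lee_fin.
  - by apply: measurable_funTS; exact/measurable_EFinP.
  - by move=> w _; rewrite lee_fin.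
  - by apply: measurable_funTS; exact/measurable_EFinP.
by rewrite !intD// leeD// ?le1 ?le2.
Qed.

Lemma cond_le0 : cond_le (fun=> 0) (fun=> 0).
Proof. by apply: cond_le_refl => //; exact: measurable_cst. Qed.

Lemma cond_le_sum (I : Type) (r : seq I) (f g : I -> Omega -> R) :
  (forall i, cond_le (f i) (g i)) ->
  cond_le (fun w => \sum_(i <- r) f i w) (fun w => \sum_(i <- r) g i w).
Proof.
move=> fg; elim: r => [|i r ih].
  have -> : (fun w => \sum_(i <- [::]) f i w) = (fun=> 0).
    by apply/funext => w; rewrite big_nil.
  have -> : (fun w => \sum_(i <- [::]) g i w) = (fun=> 0).
    by apply/funext => w; rewrite big_nil.
  exact: cond_le0.
have E (h : I -> Omega -> R) : (fun w => \sum_(j <- i :: r) h j w) =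
    (fun w => h i w + \sum_(j <- r) h j w).
  by apply/funext => w; rewrite big_cons.
by rewrite !E; exact: cond_leD.
Qed.

Lemma cond_leM (phi f g : Omega -> R) :
  measurable_fun (setT : set OG) phi -> (forall w, 0 <= phi w) ->
  cond_le f g -> cond_le (fun w => phi w * f w) (fun w => phi w * g w).
Proof.
move=> mphi phi0 [mf mg f0 g0 le].
have mphiT := wrt_measurable sG Gm mphi.
split.
- exact: measurable_funM.
- exact: measurable_funM.
- by move=> w; exact: mulr_ge0.
- by move=> w; exact: mulr_ge0.
move=> A GA; rewrite integral_indicatorE [leRHS]integral_indicatorE.
under eq_integral do rewrite mulrA.
under [leRHS]eq_integral do rewrite mulrA.
apply: (integral_weight_le sG Gm mf mg f0 g0 le).
  by apply: measurable_funM => //; apply: measurable_indic; exact: sub_sigma_algebra.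
by move=> w; rewrite mulr_ge0// indicE.
Qed.

Lemma cond_le_trans (f f' g g' : Omega -> R) :
  measurable_fun setT f -> (forall w, 0 <= f w) ->
  {ae P, forall w, f w <= f' w} ->
  measurable_fun setT g' -> (forall w, g w <= g' w) ->
  cond_le f' g -> cond_le f g'.
Proof.
move=> mf f0 ff' mg' gg' [mf' mg f'0 g0 le]; split => //.
  by move=> w; exact: le_trans (gg' w).
move=> A GA; have mA := Gm GA.
apply: le_trans (le_trans (le A GA) _).
  apply: ae_ge0_le_integral => //.
  - by move=> w _; rewrite lee_fin.
  - by apply: measurable_funTS; exact/measurable_EFinP.
  - by move=> w _; rewrite lee_fin.
  - by apply: measurable_funTS; exact/measurable_EFinP.
  - by apply: filterS ff' => w h _; rewrite lee_fin.
apply: ge0_le_integral => //.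
- by move=> w _; rewrite lee_fin.
- by apply: measurable_funTS; exact/measurable_EFinP.
- by apply: measurable_funTS; exact/measurable_EFinP.
- by move=> w _; rewrite lee_fin.
Qed.

(** An almost surely finite version may be replaced by its finite part, so that
    all further computations take place in the real numbers. *)
Lemma cond_exp_version_fine (Y : Omega -> R) (Z : Omega -> \bar R) :
  measurable_fun setT Y -> (forall w, 0 <= Y w) ->
  cond_exp_version P G (fun w => (Y w)%:E) Z ->
  {ae P, forall w, Z w \is a fin_num} ->
  [/\ measurable_fun (setT : set OG) (fun w => fine (Z w)),
      (forall w, 0 <= fine (Z w)) & cond_le Y (fun w => fine (Z w))].
Proof.
move=> mY Y0 [ZG Z0 ZY] Zfin.
have mZG : measurable_fun (setT : set OG) Z.
  move=> _ B mB; apply: sub_sigma_algebra; apply: ZG; exists B => //.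
have mZ : measurable_fun (setT : set Omega) Z by exact: (wrt_measurable sG Gm mZG).
have mfZ : measurable_fun (setT : set OG) (fun w => fine (Z w)).
  exact: (measurableT_comp (fine_measurable measurableT)).
have mfZT := wrt_measurable sG Gm mfZ.
have fZ0 w : 0 <= fine (Z w) by exact: fine_ge0.
split => //; split => // A GA; rewrite -ZY//.
rewrite (@ge0_ae_eq_integral _ _ _ _ _ Z (fun w => (fine (Z w))%:E))//.
- exact: Gm.
- exact: measurable_funTS.
- by apply: measurable_funTS; exact/measurable_EFinP.
- by move=> w _; rewrite lee_fin.
- by apply: filterS Zfin => w Zw _; rewrite fineK.
Qed.

Lemma cond_le_indep (A : set Omega) : d.-measurable A ->
  (forall B, G B -> P (A `&` B) = (P A * P B)%E) ->
  cond_le \1_A (fun=> fine (P A)).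
Proof.
move=> mA indep; split.
- exact: measurable_indic.
- exact: measurable_cst.
- by move=> w; rewrite indicE.
- by move=> w; exact: fine_ge0.
move=> B GB; have mB := Gm GB.
have -> : (\int[P]_(w in B) (\1_A w)%:E = P (A `&` B))%E by exact: integral_indic.
rewrite indep// (_ : \int[P]_(w in B) (fine (P A))%:E = P A * P B)%E//.
have := integral_cst P mB (P A).
have PA : P A \is a fin_num by exact: fin_num_measure.
rewrite -(fineK PA) => /= ->.
by rewrite fineK.
Qed.

End conditional_domination.

(** * The filtration of the iterates *)
Section natural_filtration.
Context {d : measure_display} {Omega : measurableType d}.
Context {d' : measure_display} {T : measurableType d'}.
Variable X : nat -> Omega -> T.

Lemma sigma_rvs_sigma_algebra n : sigma_algebra setT (sigma_rvs X n).
Proof. exact: smallest_sigma_algebra. Qed.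

Let pre k : set (set Omega) := preimage_set_system setT (X k) measurable.

Let gen_preimage n A (B : set T) : measurable B -> (n < A)%N ->
  (\big[setU/set0]_(i < A) preimage_set_system setT (X i) measurable) (X n @^-1` B).
Proof.
move=> mB nA; rewrite -(bigcup_mkord A pre); exists n => //.
by exists B => //; rewrite setTI.
Qed.

Lemma sigma_rvs_adapted n :
  measurable_fun (setT : set (g_sigma_algebraType (sigma_rvs X n))) (X n).
Proof.
move=> _ B mB; rewrite setTI; apply: sub_sigma_algebra.
by apply: sub_sigma_algebra; exact: gen_preimage.
Qed.

Lemma sigma_rvsS n : sigma_rvs X n `<=` sigma_rvs X n.+1.
Proof.
apply: smallest_sub; first exact: smallest_sigma_algebra.
rewrite -(bigcup_mkord n.+1 pre) => _ [k /= kn [B mB <-]]; rewrite setTI.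
by apply: sub_sigma_algebra; apply: gen_preimage => //; exact: ltnW.
Qed.

Lemma sigma_rvs_measurable n : (forall k, measurable_fun setT (X k)) ->
  sigma_rvs X n `<=` measurable.
Proof.
move=> mX; apply: smallest_sub; first exact: sigma_algebra_measurable.
by rewrite -(bigcup_mkord n.+1 pre) => _ [k _ [B mB <-]]; exact: mX.
Qed.

End natural_filtration.

Lemma cvg_same_dist {R : realType} {V : normedModType R} (u v : nat -> V) (l : V) :
  u @ \oo --> (0 : V) -> (forall n, `|v n - l| = `|u n|) -> v @ \oo --> l.
Proof.
move=> /cvgrPdist_le u0 vE; apply/cvgrPdist_le => e e0.
by apply: filterS (u0 e e0) => n; rewrite sub0r normrN distrC vE.
Qed.

(** * One step of the iteration *)
Section one_step.
Context {R : realType} {V : hilbertType R}.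
Implicit Types x y z : V.

(** Convexity of the square reduces the claim to a bound for
    [|T (S x) - z|^2], to which the inequality of averaged operators is applied
    twice, first for [T] between [S x] and [S z], then for [S] between [x] and
    [z]. *)
Lemma averaged_step (alpha beta lam : R) (T S : V -> V) x z :
  0 < alpha -> 0 < beta -> 0 < lam <= 1 ->
  averaged alpha T -> averaged beta S -> T (S z) = z ->
  `|(x + lam *: (T (S x) - x)) - z| ^+ 2 +
    lam * ((1 - alpha) / alpha * `|(S x - T (S x)) - (S z - z)| ^+ 2 +
           (1 - beta) / beta * `|(x - S x) - (z - S z)| ^+ 2) <= `|x - z| ^+ 2.
Proof.
move=> a0 b0 /andP[l0 l1] aT aS Tz.
have hT := averaged_le a0 aT (S x) (S z); rewrite Tz in hT.
have hS := averaged_le b0 aS x z.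
have -> : (x + lam *: (T (S x) - x)) - z = (1 - lam) *: (x - z) + lam *: (T (S x) - z).
  apply/esym; rewrite scalerBl scale1r -addrA [- _ + _]addrC -scalerBr.
  by rewrite opprB addrA subrK addrAC.
rewrite norm_convex.
move: hT hS; move: ((1 - alpha) / alpha * _) ((1 - beta) / beta * _) => u v.
move: (`|T (S x) - z| ^+ 2) (`|S x - S z| ^+ 2) (`|x - z| ^+ 2) => A B C hT hS.
have := sqr_ge0 (`|x - z - (T (S x) - z)|).
move: (`|x - z - (T (S x) - z)| ^+ 2) => D D0.
have h1 : 0 <= lam * (1 - lam) * D by rewrite mulr_ge0// mulr_ge0 ?subr_ge0// ltW.
have h2 : lam * (A + u + v) <= lam * C by rewrite ler_wpM2l ?(ltW l0)//; apply: le_trans hS; rewrite lerD2r.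
rewrite mulrDr; move: h1 h2; rewrite !mulrDr mulrBl mul1r. lra.
Qed.

(** As [T] is nonexpansive and [T \o S] preserves the distance from [z] to [z'],
    so does [S]; then the inequality of averaged operators leaves no room for
    its residual term. *)
Lemma fixed_residual_eq (alpha beta : R) (T S : V -> V) z z' :
  averaged alpha T -> 0 < beta < 1 -> averaged beta S ->
  T (S z) = z -> T (S z') = z' -> S z - z = S z' - z'.
Proof.
move=> [/nonexpansiveP nT _] /andP[b0 b1] aS Tz Tz'.
have hS := averaged_le b0 aS z z'.
have hT : `|z - z'| ^+ 2 <= `|S z - S z'| ^+ 2.
  by rewrite ler_sqr ?nnegrE// -{1}Tz -{1}Tz'.
have c0 : 0 < (1 - beta) / beta by rewrite divr_gt0// subr_gt0.
have h0 : `|(z - S z) - (z' - S z')| ^+ 2 <= 0.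
  by rewrite -(pmulr_rle0 _ c0) -(lerD2l (`|S z - S z'| ^+ 2)) addr0 (le_trans hS).
have : (z - S z) - (z' - S z') = 0.
  by apply/eqP; rewrite -normr_eq0 -sqrf_eq0 eq_le h0 sqr_ge0.
by move/eqP; rewrite subr_eq0 => /eqP /(congr1 -%R); rewrite !opprB.
Qed.

Lemma noisy_sqr_le (lam g : R) x y : 0 < g -> 0 < lam <= 1 ->
  `|x + lam *: y| ^+ 2 <= (1 + g) * `|x| ^+ 2 + (1 + g^-1) * `|y| ^+ 2.
Proof.
move=> g0 /andP[l0 l1]; rewrite normD_sqr innerZr normrZ gtr0_norm// exprMn.
have h : 2 * (lam * inner x y) <= g * `|x| ^+ 2 + g^-1 * (lam ^+ 2 * `|y| ^+ 2).
  have := sqr_ge0 (`|g *: x - lam *: y|).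
  rewrite normB_sqr !normrZ innerZl innerZr !gtr0_norm// !exprMn => h.
  rewrite -(ler_pM2l g0) mulrDr [X in _ + X]mulrA divff ?mul1r ?gt_eqF//.
  by rewrite -subr_ge0; apply: le_trans h _; rewrite le_eqVlt; apply/orP; left; apply/eqP; ring.
have ll : lam ^+ 2 <= 1 by rewrite expr_le1// ltW.
have le2 : lam ^+ 2 * `|y| ^+ 2 <= `|y| ^+ 2 by rewrite ler_piMl// sqr_ge0.
have le3 : g^-1 * (lam ^+ 2 * `|y| ^+ 2) <= g^-1 * `|y| ^+ 2.
  by rewrite ler_wpM2l// invr_ge0 ltW.
have le4 := lerD (le_trans h (lerD (lexx _) le3)) le2.
rewrite -addrA; apply: le_trans (lerD (lexx _) le4) _.
by rewrite le_eqVlt; apply/orP; left; apply/eqP; ring.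
Qed.

Lemma sqr_normD_le x y : `|x + y| ^+ 2 <= 2 * (`|x| ^+ 2 + `|y| ^+ 2).
Proof.
have := sqr_ge0 (`|x - y|); rewrite normB_sqr normD_sqr => h.
by rewrite mulrDr; lra.
Qed.

End one_step.

Lemma nneseries_sqrte_fine {R : realType} (c : nat -> \bar R) : (forall n, 0 <= c n)%E ->
  (\sum_(0 <= n <oo) sqrte (c n) < +oo)%E ->
  (forall n, c n \is a fin_num) /\ cvgn (series (fun n => Num.sqrt (fine (c n)))).
Proof.
move=> c0 cs.
have s0 n : (0 <= sqrte (c n))%E by exact: sqrte_ge0.
have cfin n : c n \is a fin_num.
  rewrite ge0_fin_numE// ltey; apply/negP => /eqP cn.
  have := @nneseries_lim_ge _ (fun n => sqrte (c n)) xpredT 0 n.+1 (fun n _ _ => s0 n).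
  rewrite big_nat_recr//= cn /= addey; last first.
    by rewrite -ltNye (lt_le_trans ltNy0)// sume_ge0.
  by move=> h; have := le_lt_trans h cs; rewrite ltxx.
split => //; apply: nondecreasing_is_cvgn.
  by apply/nondecreasing_seqP => n; rewrite /series/= big_nat_recr//= lerDl sqrtr_ge0.
exists (fine (\sum_(0 <= n <oo) sqrte (c n))) => _ [n _ <-].
rewrite -lee_fin fineK; last first.
  by rewrite ge0_fin_numE//; exact: nneseries_ge0.
apply: le_trans (nneseries_lim_ge n _); last by [].
rewrite /series/= -sumEFin; apply: lee_sum => k _.
by rewrite -{2}(fineK (cfin k)).
Qed.

(** * Stochastic quasi-Fejer monotonicity of the block iteration *)
Section block_iteration.
Context {R : realType} {d : measure_display} {Omega : measurableType d}.
Variable P : probability Omega R.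
Variables (m : nat) (H : 'I_m -> hilbertType R).
Variables alpha beta lambda : nat -> R.
Hypothesis alpha01 : forall n, 0 < alpha n < 1.
Hypothesis alpha_sup : sup (range alpha) < 1.
Hypothesis beta01 : forall n, 0 < beta n < 1.
Hypothesis beta_sup : sup (range beta) < 1.
Hypothesis lambda01 : forall n, 0 < lambda n <= 1.
Hypothesis lambda_inf : 0 < inf (range lambda).
Variables (a b x : nat -> {RV P >-> borel (hsum H)}) (y : nat -> Omega -> hsum H).
Variable eps : nat -> {RV P >-> m.-tuple bool}.
Hypothesis eps_distr : forall n, distribution P (eps n) = distribution P (eps 0%N).
Variables Rop T : nat -> hsum H -> hsum H.
Hypothesis R_averaged : forall n, averaged (beta n) (Rop n).
Hypothesis T_averaged : forall n, averaged (alpha n) (T n).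
Hypothesis y_def : forall n,
  {ae P, forall w, y n w = Rop n (x n w) + (b n w : hsum H)}.
Hypothesis x_def : forall n (i : 'I_m),
  {ae P, forall w,
    (x n.+1 w : hsum H) i = (x n w : hsum H) i +
      ((tnth (eps n w) i)%:R * lambda n) *:
        (T n (y n w) i + (a n w : hsum H) i - (x n w : hsum H) i)}.
Variables cond_a cond_b : nat -> Omega -> \bar R.
Hypothesis cond_aP : forall n, cond_exp_version P (sigma_rvs x n)
  (fun w => (`|(a n w : hsum H)| ^+ 2)%:E) (cond_a n).
Hypothesis cond_bP : forall n, cond_exp_version P (sigma_rvs x n)
  (fun w => (`|(b n w : hsum H)| ^+ 2)%:E) (cond_b n).
Hypothesis sum_a : {ae P, forall w, (\sum_(0 <= n <oo) sqrte (cond_a n w) < +oo)%E}.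
Hypothesis sum_b : {ae P, forall w, (\sum_(0 <= n <oo) sqrte (cond_b n w) < +oo)%E}.
Hypothesis eps_indep : forall n,
  indep_sigma P (sigma_rv (eps n)) (sigma_rvs x n).
Hypothesis p_gt0 : forall i : 'I_m, (0 < P [set w | tnth (eps 0%N w) i])%E.

Local Notation G n := (sigma_rvs x n).
Local Notation OG n := (g_sigma_algebraType (sigma_rvs x n)).

Let sG n : sigma_algebra setT (G n). Proof. exact: sigma_rvs_sigma_algebra. Qed.

Let Gm n : G n `<=` measurable.
Proof. by apply: sigma_rvs_measurable => k; exact: measurable_funPT. Qed.

Let GS n : G n `<=` G n.+1. Proof. exact: sigma_rvsS. Qed.

Lemma adapted_lipschitz n (K : R) (f : hsum H -> R) :
  (forall u v, `|f u - f v| <= K * `|u - v|) ->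
  measurable_fun (setT : set (OG n)) (fun w => f (x n w)).
Proof.
move=> /dist_le_continuous cf.
apply: (measurableT_comp (continuous_borel_measurable cf)).
exact: sigma_rvs_adapted.
Qed.

Definition omega i : R := (fine (P [set w | tnth (eps 0%N w) i]))^-1.

Let p i : R := fine (P [set w | tnth (eps 0%N w) i]).

Let mask n (i : 'I_m) : set Omega := [set w | tnth (eps n w) i].

Let mask_preimage n i : mask n i = eps n @^-1` [set t : m.-tuple bool | tnth t i].
Proof. by []. Qed.

Let tnth_measurable (i : 'I_m) : measurable [set t : m.-tuple bool | tnth t i].
Proof.
have := @measurable_tnth _ bool m i measurableT [set true] Logic.I.
by rewrite setTI.
Qed.

Let mask_measurable n i : measurable (mask n i).
Proof.
rewrite mask_preimage -[X in measurable X]setTI.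
exact: (measurable_funPT (eps n)).
Qed.

Let mask_sigma n i : sigma_rv (eps n) (mask n i).
Proof. by exists [set t : m.-tuple bool | tnth t i] => //; rewrite setTI. Qed.

Let maskC_sigma n i : sigma_rv (eps n) (~` mask n i).
Proof.
exists (~` [set t : m.-tuple bool | tnth t i]); first exact: measurableC.
by rewrite setTI.
Qed.

Let P_mask n i : P (mask n i) = (p i)%:E.
Proof.
rewrite /p fineK; last by apply: fin_num_measure; exact: (mask_measurable 0%N).
have : distribution P (eps n) [set t : m.-tuple bool | tnth t i] =
  distribution P (eps 0%N) [set t : m.-tuple bool | tnth t i] by rewrite eps_distr.
by [].
Qed.

Let p0 i : 0 < p i.
Proof. by rewrite -lte_fin -(P_mask 0%N); exact: p_gt0. Qed.

Lemma omega_gt0 i : 0 < omega i.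
Proof. by rewrite invr_gt0; exact: p0. Qed.

Let lam n : inf (range lambda) <= lambda n.
Proof.
apply: inf_lbound; last by exists n.
by exists 0 => _ [k _ <-]; have /andP[/ltW] := lambda01 k.
Qed.

Let ratio_ge (u : nat -> R) n : (forall k, 0 < u k < 1) ->
  1 - sup (range u) <= (1 - u n) / u n.
Proof.
move=> u01; have /andP[u0 u1] := u01 n.
have un : u n <= sup (range u).
  apply: sup_upper_bound; last by exists n.
  split; first by exists (u n), n.
  by exists 1 => _ [k _ <-]; have /andP[_ /ltW] := u01 k.
apply: (@le_trans _ _ (1 - u n)); first by rewrite lerD2l lerN2.
by rewrite ler_pdivlMr// ler_piMr ?subr_ge0// ltW.
Qed.

Let ca n w : R := fine (cond_a n w).
Let cb n w : R := fine (cond_b n w).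
Let W : R := \sum_i omega i.
(* The square of g_n dominates 2 W times the conditional second moments of the
   errors, so that the factor 1 + 1/g_n of Young's inequality turns them into
   at most (1 + g_n) g_n.  The term 2^-(n+1) keeps g_n positive and is summable. *)
Let g n w : R := Num.sqrt (2 * W) * (Num.sqrt (ca n w) + Num.sqrt (cb n w)) + 2^-1 ^+ n.+1.

Let W0 : 0 <= W.
Proof. by apply: sumr_ge0 => i _; rewrite ltW// omega_gt0. Qed.

Let g_gt0 n w : 0 < g n w.
Proof. by rewrite ltr_wpDl ?exprn_gt0// mulr_ge0// ?addr_ge0// sqrtr_ge0. Qed.

Let a_norm_measurable n : measurable_fun setT (fun w => `|(a n w : hsum H)| ^+ 2).
Proof.
apply: measurable_funX.
apply: (@measurableT_comp _ _ _ _ (borel (hsum H)) _ (fun u : hsum H => `|u|)).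
  by apply: continuous_borel_measurable; exact: norm_continuous.
exact: measurable_funPT.
Qed.

Let b_norm_measurable n : measurable_fun setT (fun w => `|(b n w : hsum H)| ^+ 2).
Proof.
apply: measurable_funX.
apply: (@measurableT_comp _ _ _ _ (borel (hsum H)) _ (fun u : hsum H => `|u|)).
  by apply: continuous_borel_measurable; exact: norm_continuous.
exact: measurable_funPT.
Qed.

Let ae_a : {ae P, forall w, (forall n, cond_a n w \is a fin_num) /\
  cvgn (series (fun n => Num.sqrt (ca n w)))}.
Proof.
apply: filterS sum_a => w; apply: nneseries_sqrte_fine => n.
by have [_ + _] := cond_aP n.
Qed.

Let ae_b : {ae P, forall w, (forall n, cond_b n w \is a fin_num) /\
  cvgn (series (fun n => Num.sqrt (cb n w)))}.
Proof.
apply: filterS sum_b => w; apply: nneseries_sqrte_fine => n.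
by have [_ + _] := cond_bP n.
Qed.

Let caP n : [/\ measurable_fun (setT : set (OG n)) (ca n),
  (forall w, 0 <= ca n w) &
  cond_le P (G n) (fun w => `|(a n w : hsum H)| ^+ 2) (ca n)].
Proof.
apply: (cond_exp_version_fine (sG n) (@Gm n)) (cond_aP n) _ => //.
by apply: filterS ae_a => w [].
Qed.

Let cbP n : [/\ measurable_fun (setT : set (OG n)) (cb n),
  (forall w, 0 <= cb n w) &
  cond_le P (G n) (fun w => `|(b n w : hsum H)| ^+ 2) (cb n)].
Proof.
apply: (cond_exp_version_fine (sG n) (@Gm n)) (cond_bP n) _ => //.
by apply: filterS ae_b => w [].
Qed.

Let sqrt_measurable n (f : OG n -> R) : measurable_fun setT f ->
  measurable_fun setT (fun w => Num.sqrt (f w)).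
Proof.
move=> mf; apply: (measurableT_comp _ mf).
by apply: continuous_measurable_fun; exact: sqrt_continuous.
Qed.

Let g_measurable n : measurable_fun (setT : set (OG n)) (g n).
Proof.
have [mca _ _] := caP n; have [mcb _ _] := cbP n.
apply: measurable_funD; last exact: measurable_cst.
apply: measurable_funM; first exact: measurable_cst.
by apply: measurable_funD; exact: sqrt_measurable.
Qed.

Let g_cvg : {ae P, forall w, cvgn (series (g ^~ w))}.
Proof.
apply: filterS2 ae_a ae_b => w [_ sa] [_ sb].
have -> : series (g^~ w) = (fun n => Num.sqrt (2 * W) *
     (series (fun k => Num.sqrt (ca k w)) n + series (fun k => Num.sqrt (cb k w)) n)
     + series (geometric 2^-1 2^-1) n).
  apply/funext => n; rewrite /series/= -big_split/= mulr_sumr -big_split/=.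
  by apply: eq_bigr => k _; rewrite /g exprS.
apply: is_cvgD; last first.
  by apply: is_cvg_geometric_series; rewrite gtr0_norm ?invr_gt0// invf_lt1// ltr1n.
apply: is_cvgM; first exact: is_cvg_cst.
exact: is_cvgD.
Qed.

Let noise_le n w : 2 * W * (ca n w + cb n w) <= g n w ^+ 2.
Proof.
have [_ ca0 _] := caP n; have [_ cb0 _] := cbP n.
set s := Num.sqrt (ca n w) + Num.sqrt (cb n w).
have s0 : 0 <= s by rewrite addr_ge0// sqrtr_ge0.
have W2 : 0 <= 2 * W by rewrite mulr_ge0.
apply: (@le_trans _ _ ((Num.sqrt (2 * W) * s) ^+ 2)).
  rewrite exprMn sqr_sqrtr// ler_wpM2l// /s sqrrD !sqr_sqrtr//.
  by rewrite -addrA lerD2l -[leLHS]add0r lerD2r mulrn_wge0// mulr_ge0 ?sqrtr_ge0.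
rewrite ler_sqr ?nnegrE ?mulr_ge0 ?sqrtr_ge0//; last exact: ltW.
by rewrite /g -/s lerDl exprn_ge0.
Qed.

Section fixed_point.
Variable z : hsum H.
Hypothesis Fz : forall n, T n (Rop n z) = z.

Let lam0 := inf (range lambda).
Let a0 := 1 - sup (range alpha).
Let b0 := 1 - sup (range beta).

Let xi n w : R := wsq omega ((x n w : hsum H) - z).

(* the residuals of T_n and R_n, relative to their values at z *)
Let rT n (u : hsum H) := (Rop n u - T n (Rop n u)) - (Rop n z - z).
Let rR n (u : hsum H) := (u - Rop n u) - (z - Rop n z).

Let theta n w : R := lam0 * (a0 * `|rT n (x n w)| ^+ 2 + b0 * `|rR n (x n w)| ^+ 2).

(* error-free update of all the blocks, relative to z *)
Let upd n (u : hsum H) : hsum H := (u + lambda n *: (T n (Rop n u) - u)) - z.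

Let nT n u v : `|T n u - T n v| <= `|u - v|.
Proof. by have [/nonexpansiveP] := T_averaged n. Qed.

Let nR n u v : `|Rop n u - Rop n v| <= `|u - v|.
Proof. by have [/nonexpansiveP] := R_averaged n. Qed.

Let adapted_norm n (K : R) (f : hsum H -> R) :
  (forall u v, `|f u - f v| <= K * `|u - v|) ->
  measurable_fun (setT : set (OG n)) (fun w => (f (x n w)) ^+ 2).
Proof. by move=> fl; apply: measurable_funX; exact: adapted_lipschitz fl. Qed.

Let A n i w : R := `|((x n w : hsum H) - z) i| ^+ 2.
Let C n i w : R := `|upd n (x n w) i| ^+ 2.

Let A_measurable n i : measurable_fun (setT : set (OG n)) (A n i).
Proof.
apply: (@adapted_norm n 1 (fun u => `|(u - z) i|)) => u v; rewrite mul1r.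
apply: le_trans (ler_dist_dist _ _) _.
have -> : (u - z) i - (v - z) i = (u - v) i.
  by rewrite -[LHS]/((u - z - (v - z)) i) subrBB.
exact: hsum_coord_le.
Qed.

Let C_measurable n i : measurable_fun (setT : set (OG n)) (C n i).
Proof.
apply: (@adapted_norm n 3 (fun u => `|upd n u i|)) => u v.
apply: le_trans (ler_dist_dist _ _) _.
rewrite -[upd n u i - upd n v i]/((upd n u - upd n v) i).
apply: le_trans (hsum_coord_le _ _) _.
have /andP[l0 l1] := lambda01 n.
have -> : upd n u - upd n v =
    (u - v) + lambda n *: ((T n (Rop n u) - T n (Rop n v)) - (u - v)).
  by rewrite /upd subrBB opprD addrACA -scalerBr subrACA.
apply: le_trans (ler_normD _ _) _; rewrite normrZ gtr0_norm//.
apply: (@le_trans _ _ (`|u - v| + (`|u - v| + `|u - v|))); last first.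
  by rewrite -{1 2 3}[`|u - v|]mul1r -!mulrDl; apply: ler_wpM2r => //; lra.
rewrite lerD2l; apply: le_trans (ler_piMl _ l1) _ => //.
apply: le_trans (ler_normB _ _) _; rewrite lerD2r.
exact: le_trans (nT _ _ _) (nR _ _ _).
Qed.

Let rT_measurable n : measurable_fun (setT : set (OG n)) (fun w => `|rT n (x n w)| ^+ 2).
Proof.
apply: (@adapted_norm n 2 (fun u => `|rT n u|)) => u v.
apply: le_trans (ler_dist_dist _ _) _.
have -> : rT n u - rT n v = (Rop n u - Rop n v) - (T n (Rop n u) - T n (Rop n v)).
  by rewrite /rT subrBB subrACA.
apply: le_trans (ler_normB _ _) _; rewrite mulr_natl mulr2n lerD//.
exact: le_trans (nT _ _ _) (nR _ _ _).
Qed.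

Let rR_measurable n : measurable_fun (setT : set (OG n)) (fun w => `|rR n (x n w)| ^+ 2).
Proof.
apply: (@adapted_norm n 2 (fun u => `|rR n u|)) => u v.
apply: le_trans (ler_dist_dist _ _) _.
have -> : rR n u - rR n v = (u - v) - (Rop n u - Rop n v).
  by rewrite /rR subrBB subrACA.
by apply: le_trans (ler_normB _ _) _; rewrite mulr_natl mulr2n lerD.
Qed.

Let xiE n w : xi n w = \sum_i omega i * A n i w.
Proof. by []. Qed.

Let xi_measurable n : measurable_fun (setT : set (OG n)) (xi n).
Proof.
have -> : xi n = (fun w => \sum_i omega i * A n i w) by apply/funext => w; rewrite xiE.
apply: measurable_sum => i; apply: measurable_funM => //; exact: measurable_cst.
Qed.

Let theta_measurable n : measurable_fun (setT : set (OG n)) (theta n).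
Proof.
apply: measurable_funM; first exact: measurable_cst.
by apply: measurable_funD; apply: measurable_funM => //; exact: measurable_cst.
Qed.

Let xi_ge0 n w : 0 <= xi n w.
Proof. by apply: wsq_ge0 => i; exact: omega_gt0. Qed.

Let a0_gt0 : 0 < a0. Proof. by rewrite subr_gt0. Qed.
Let b0_gt0 : 0 < b0. Proof. by rewrite subr_gt0. Qed.

Let theta_ge0 n w : 0 <= theta n w.
Proof.
rewrite /theta mulr_ge0 ?(ltW lambda_inf)// addr_ge0// mulr_ge0 ?sqr_ge0//; exact: ltW.
Qed.

Let sum_A n w : \sum_i A n i w = `|(x n w : hsum H) - z| ^+ 2.
Proof. by rewrite -hsum_normsq. Qed.

(* The infimum of lambda and the suprema of alpha and beta enter here: they
   bound the coefficients of averaged_step from below, uniformly in n. *)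
Let sum_C_le n w : \sum_i C n i w + theta n w <= \sum_i A n i w.
Proof.
have -> : \sum_i C n i w = `|upd n (x n w)| ^+ 2 by rewrite -hsum_normsq.
have /andP[al0 _] := alpha01 n; have /andP[be0 _] := beta01 n.
have := averaged_step (x n w : hsum H) al0 be0 (lambda01 n) (T_averaged n) (R_averaged n) (Fz n).
rewrite sum_A; apply: le_trans; rewrite lerD2l /theta.
have ra := ratio_ge n alpha01; have rb := ratio_ge n beta01.
apply: ler_pM => //; first exact: ltW.
  by rewrite addr_ge0// mulr_ge0// ?sqr_ge0// ltW.
by apply: lerD; apply: ler_wpM2r; rewrite ?sqr_ge0.
Qed.

(* The weighted square after an error-free random update, and its conditional
   expectation, in which the mask is replaced by its probability. *)
Let S n w : R := \sum_i ((omega i * A n i w) * \1_(~` mask n i) w +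
                         (omega i * C n i w) * \1_(mask n i) w).

Let ES n w : R := \sum_i ((omega i * A n i w) * fine (P (~` mask n i)) +
                          (omega i * C n i w) * fine (P (mask n i))).

Let S_cond_le n : cond_le P (G n) (S n) (ES n).
Proof.
apply: cond_le_sum => [|i]; first exact: Gm.
have om0 := ltW (omega_gt0 i).
apply: (cond_leD (@Gm n)); apply: (cond_leM (sG n) (@Gm n)).
- by apply: measurable_funM => //; exact: measurable_cst.
- by move=> w; rewrite mulr_ge0// sqr_ge0.
- apply: (cond_le_indep (@Gm n)); first exact: measurableC.
  move=> B GB.
  by apply: eps_indep.
- by apply: measurable_funM => //; exact: measurable_cst.
- by move=> w; rewrite mulr_ge0// sqr_ge0.
- apply: (cond_le_indep (@Gm n)); first by [].
  move=> B GB.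
  by apply: eps_indep.
Qed.

(* The weight of block i is 1 / P (mask n i), so that the random update of the
   blocks changes the weighted square by the unweighted quantity
   sum_C - sum_A on average. *)
Let ES_le n w : ES n w + theta n w <= xi n w.
Proof.
have -> : ES n w = xi n w - \sum_i A n i w + \sum_i C n i w.
  rewrite xiE -sumrB -big_split/=; apply: eq_bigr => i _.
  have -> : P (~` mask n i) = (1 - p i)%:E.
    by rewrite probability_setC// P_mask.
  rewrite P_mask /= /omega -/(p i); field; rewrite gt_eqF//.
by have := sum_C_le n w; lra.
Qed.

Let noise n w : R := ((1 + (g n w)^-1) * (2 * W)) *
  (`|(a n w : hsum H)| ^+ 2 + `|(b n w : hsum H)| ^+ 2).

Let step_le n : {ae P, forall w, xi n.+1 w <= (1 + g n w) * S n w + noise n w}.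
Proof.
have aeX := ae_forall_count (x_def n).
apply: filterS2 aeX (y_def n) => w xE yE.
pose e : hsum H := (T n (y n w) - T n (Rop n (x n w))) + (a n w : hsum H).
have e_le : `|e| ^+ 2 <= 2 * (`|(a n w : hsum H)| ^+ 2 + `|(b n w : hsum H)| ^+ 2).
  apply: le_trans (sqr_normD_le _ _) _; rewrite ler_wpM2l// addrC lerD2l.
  rewrite ler_sqr ?nnegrE//; apply: le_trans (nT _ _ _) _.
  by rewrite yE addrC addKr.
have g0 := g_gt0 n w.
have coord i : omega i * `|((x n.+1 w : hsum H) - z) i| ^+ 2 <=
   (1 + g n w) * ((omega i * A n i w) * \1_(~` mask n i) w +
                  (omega i * C n i w) * \1_(mask n i) w) +
   omega i * ((1 + (g n w)^-1) * `|e| ^+ 2).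
  have om0 := omega_gt0 i.
  rewrite -[((x n.+1 w : hsum H) - z) i]/((x n.+1 w : hsum H) i - z i) xE.
  have e0 : 0 <= (1 + (g n w)^-1) * `|e| ^+ 2.
    by rewrite mulr_ge0 ?sqr_ge0// addr_ge0// invr_ge0 ltW.
  rewrite !indicE; have [mw|mw] := boolP (tnth (eps n w) i); last first.
    rewrite mem_set/=; last exact/negP.
    rewrite memNset/=; last exact/negP.
    rewrite mul0r scale0r addr0 mulr1 mulr0 addr0 [(1 + g n w) * _]mulrCA -mulrDr ler_wpM2l ?(ltW om0)//.
    rewrite -[x n w i - z i]/(((x n w : hsum H) - z) i) -/(A n i w).
    rewrite mulrDl mul1r -addrA lerDl addr_ge0// mulr_ge0 ?(ltW g0)//.
    exact: sqr_ge0.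
  rewrite memNset/=; last by move=> /(_ mw).
  rewrite mem_set//= mul1r mulr1 mulr0 add0r [(1 + g n w) * _]mulrCA -mulrDr ler_wpM2l ?(ltW om0)//.
  have -> : x n w i + lambda n *: (T n (y n w) i + a n w i - x n w i) - z i =
      upd n (x n w) i + lambda n *: e i.
    rewrite -[upd n (x n w) i]/(x n w i + lambda n *: (T n (Rop n (x n w)) i - x n w i) - z i).
    rewrite -[e i]/(T n (y n w) i - T n (Rop n (x n w)) i + (a n w : hsum H) i).
    rewrite [RHS]addrAC; congr (_ - _); rewrite -[RHS]addrA -scalerDr; congr (_ + _ *: _).
    by rewrite [RHS]addrC addrA [T n (y n w) i - _ + _ + _]addrAC subrK.
  apply: le_trans (noisy_sqr_le _ _ g0 (lambda01 n)) _; rewrite lerD2l.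
  rewrite ler_wpM2l//; first by rewrite addr_ge0// invr_ge0 ltW.
  by rewrite ler_sqr ?nnegrE//; exact: hsum_coord_le.
rewrite /xi /wsq; apply: le_trans (ler_sum _ (fun i _ => coord i)) _.
rewrite big_split/= -mulr_sumr lerD2l -mulr_suml -/W /noise.
have gi0 : 0 <= 1 + (g n w)^-1 by rewrite addr_ge0// invr_ge0 ltW.
apply: le_trans (ler_wpM2l W0 (ler_wpM2l gi0 e_le)) _.
by rewrite le_eqVlt; apply/orP; left; apply/eqP; ring.
Qed.

Let xi_step n B : G n B ->
  (\int[P]_(w in B) (xi n.+1 w + (1 + g n w) * theta n w)%:E <=
   \int[P]_(w in B) ((1 + g n w) * (xi n w + g n w))%:E)%E.
Proof.
have [mca ca0 cale] := caP n; have [mcb cb0 cble] := cbP n.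
have m1g : measurable_fun (setT : set (OG n)) (fun w => 1 + g n w).
  by apply: measurable_funD => //; exact: measurable_cst.
have g1 w : 0 <= 1 + g n w by rewrite addr_ge0// ltW.
have toT k (u : Omega -> R) : measurable_fun (setT : set (OG k)) u ->
    measurable_fun (setT : set Omega) u.
  by move=> mu; exact: (wrt_measurable (sG k) (@Gm k) mu).
have le1 := cond_leM (sG n) (@Gm n) m1g g1 (S_cond_le n).
have phi0 w : 0 <= (1 + (g n w)^-1) * (2 * W).
  by rewrite !mulr_ge0// addr_ge0// invr_ge0 ltW.
have mphi : measurable_fun (setT : set (OG n)) (fun w => (1 + (g n w)^-1) * (2 * W)).
  apply: measurable_funM; last exact: measurable_cst.
  apply: measurable_funD; first exact: measurable_cst.
  by apply: measurable_funV_ge0 => // w; exact: ltW.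
have le2 := cond_leM (sG n) (@Gm n) mphi phi0 (cond_leD (@Gm n) cale cble).
have mt : measurable_fun (setT : set Omega) (fun w => (1 + g n w) * theta n w).
  by apply: (toT n); exact: measurable_funM.
have t0 w : 0 <= (1 + g n w) * theta n w by rewrite mulr_ge0.
have le3 := cond_le_refl P (G n) mt t0.
have le4 := cond_leD (@Gm n) (cond_leD (@Gm n) le1 le2) le3.
have xiT := toT _ _ (@xi_measurable n.+1).
move=> GB; suff [_ _ _ _ h] : cond_le P (G n)
    (fun w => xi n.+1 w + (1 + g n w) * theta n w)
    (fun w => (1 + g n w) * (xi n w + g n w)) by exact: h.
apply: (cond_le_trans (@Gm n) _ _ _ _ _ le4).
- exact: measurable_funD.
- by move=> w; exact: addr_ge0.
- by apply: filterS (step_le n) => w hw; rewrite lerD2r.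
- apply: (toT n); apply: measurable_funM => //; exact: measurable_funD.
- move=> w; have gw := g_gt0 n w.
  have h1 : (1 + (g n w)^-1) * (2 * W) * (ca n w + cb n w) <= (1 + g n w) * g n w.
    rewrite (_ : (1 + g n w) * g n w = (1 + (g n w)^-1) * g n w ^+ 2); last first.
      by field; rewrite gt_eqF.
    by rewrite -mulrA ler_wpM2l// addr_ge0// invr_ge0 ltW.
  rewrite addrAC -mulrDr [leRHS]mulrDr lerD//.
  by rewrite ler_wpM2l.
Qed.

(** The Robbins-Siegmund theorem for the weighted squared distance to a common
    fixed point [z]. *)
Lemma quasi_fejer : {ae P, forall w,
  cvgn (fun n => wsq omega ((x n w : hsum H) - z)) /\
  ((Rop n (x n w) - T n (Rop n (x n w))) - (Rop n z - z)
     @[n --> \oo] --> (0 : hsum H)) /\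
  (((x n w : hsum H) - Rop n (x n w)) - (z - Rop n z)
     @[n --> \oo] --> (0 : hsum H))}.
Proof.
have g0 n w : 0 <= g n w by exact: ltW.
have := robbins_siegmund sG Gm GS xi_ge0 theta_ge0 g0 xi_measurable
  theta_measurable g_measurable xi_step g_cvg.
apply: filterS => w [cxi /cvg_series_cvg_0 th0]; split=> //.
have l0 : 0 < lam0 by [].
have small (c : R) (r : nat -> hsum H) : 0 < c ->
    (forall n, lam0 * (c * `|r n| ^+ 2) <= theta n w) ->
    r @ \oo --> (0 : hsum H).
  move=> c0 rth; apply/cvgrPdist_lt => e e0.
  have d0 : 0 < lam0 * (c * e ^+ 2) by rewrite !mulr_gt0// exprn_gt0.
  have /cvgrPdist_lt/(_ _ d0) := th0; apply: filterS => n.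
  rewrite !sub0r !normrN ger0_norm// => h.
  rewrite -(@ltr_pXn2r _ 2)// ?nnegrE ?(ltW e0)//.
  by have := le_lt_trans (rth n) h; rewrite !ltr_pM2l.
split.
- apply: (small a0) => // n; rewrite /theta ler_wpM2l ?(ltW l0)// lerDl.
  by rewrite mulr_ge0 ?sqr_ge0// ltW.
- apply: (small b0) => // n; rewrite /theta ler_wpM2l ?(ltW l0)// lerDr.
  by rewrite mulr_ge0 ?sqr_ge0// ltW.
Qed.

End fixed_point.
End block_iteration.

(** * Convergence of the iterates *)

(** The scalar products of the limit with fixed vectors are limits of measurable
    functions off the exceptional set [N]. *)
Lemma weak_limit_measurable {R : realType} {V : hilbertType R}
    {d : measure_display} {Omega : measurableType d} (s : nat -> V)
    (u : nat -> Omega -> V) (f : Omega -> V) (N : set Omega) (z : V) :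
  approximable setT s -> measurable N ->
  (forall n, measurable_fun setT (u n : Omega -> borel V)) ->
  (forall w, N w -> f w = z) ->
  (forall w, ~ N w -> weakly_cvg (u^~ w) (f w)) ->
  measurable_fun setT (f : Omega -> borel V).
Proof.
move=> sd mN mu fN fnN; apply: (weakly_measurable sd) => v.
pose h n w : R := \1_N w * inner z v + \1_(~` N) w * inner (u n w) v.
apply: (measurable_fun_cvg (h := h)) => [n|w _].
  apply: measurable_funD; apply: measurable_funM.
  - exact: measurable_indic.
  - exact: measurable_cst.
  - by apply: measurable_indic; exact: measurableC.
  - apply: (measurableT_comp (continuous_borel_measurable (@inner_continuous _ _ v))).
    exact: mu.
have [Nw|nNw] := pselect (N w).
  have -> : h^~ w = (fun=> inner (f w) v).
    apply/funext => n; rewrite /h !indicE mem_set// memNset/=; last by move=> /(_ Nw).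
    by rewrite mul1r mul0r addr0 fN.
  exact: cvg_cst.
have -> : h^~ w = (fun n => inner (u n w) v).
  apply/funext => n; rewrite /h !indicE memNset// mem_set//=.
  by rewrite mul1r mul0r add0r.
exact: fnN.
Qed.

Theorem theorem4p1 (R : realType)
  (d : measure_display) (Omega : measurableType d) (P : probability Omega R)
  (m : nat) (H : 'I_m -> hilbertType R)
  (Hsep : forall i, separable_space (H i))
  (alpha beta lambda : nat -> R)
  (alpha01 : forall n, 0 < alpha n < 1) (alpha_sup : sup (range alpha) < 1)
  (beta01 : forall n, 0 < beta n < 1) (beta_sup : sup (range beta) < 1)
  (lambda01 : forall n, 0 < lambda n <= 1)
  (lambda_inf : 0 < inf (range lambda))
  (a b x : nat -> {RV P >-> borel (hsum H)}) (y : nat -> Omega -> hsum H)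
  (eps : nat -> {RV P >-> m.-tuple bool})
  (eps_mask : forall n w, nonzero_masks (eps n w))
  (eps_distr : forall n, distribution P (eps n) = distribution P (eps 0%N))
  (Rop T : nat -> hsum H -> hsum H)
  (R_averaged : forall n, averaged (beta n) (Rop n))
  (T_averaged : forall n, averaged (alpha n) (T n))
  (y_def : forall n,
    {ae P, forall w, y n w = Rop n (x n w) + (b n w : hsum H)})
  (x_def : forall n (i : 'I_m),
    {ae P, forall w,
      (x n.+1 w : hsum H) i = (x n w : hsum H) i +
        ((tnth (eps n w) i)%:R * lambda n) *:
          (T n (y n w) i + (a n w : hsum H) i - (x n w : hsum H) i)})
  (F := \bigcap_n Fix (T n \o Rop n))
  (F_neq0 : F !=set0)
  (cond_a cond_b : nat -> Omega -> \bar R)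
  (cond_aP : forall n, cond_exp_version P (sigma_rvs x n)
    (fun w => (`|(a n w : hsum H)| ^+ 2)%:E) (cond_a n))
  (cond_bP : forall n, cond_exp_version P (sigma_rvs x n)
    (fun w => (`|(b n w : hsum H)| ^+ 2)%:E) (cond_b n))
  (sum_a : {ae P, forall w, (\sum_(0 <= n <oo) sqrte (cond_a n w) < +oo)%E})
  (sum_b : {ae P, forall w, (\sum_(0 <= n <oo) sqrte (cond_b n w) < +oo)%E})
  (eps_indep : forall n, indep_sigma P (sigma_rv (eps n)) (sigma_rvs x n))
  (p_gt0 : forall i : 'I_m, (0 < P [set w | tnth (eps 0%N w) i])%E) :
  [/\ {ae P, forall w, forall z, F z ->
         T n (Rop n (x n w)) - Rop n (x n w) + Rop n z @[n --> \oo] --> z},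
      {ae P, forall w, forall z, F z ->
         (x n w : hsum H) - Rop n (x n w) + Rop n z @[n --> \oo] --> z} &
      {ae P, forall w, weak_cluster (fun n => x n w : hsum H) `<=` F} ->
      exists xlim : {RV P >-> borel (hsum H)},
        [/\ forall w, F (xlim w),
            {ae P, forall w, weakly_cvg (fun n => x n w : hsum H) (xlim w)} &
            {ae P, forall w, strong_cluster (fun n => x n w : hsum H) !=set0} ->
            {ae P, forall w, (x n w : hsum H) @[n --> \oo] --> (xlim w : hsum H)}]].
Proof.
have [z0 Fz0] := F_neq0.
have FP z : F z -> forall n, T n (Rop n z) = z by move=> Fz n; exact: (Fz n Logic.I).
have qf z (Fz : F z) := quasi_fejer alpha01 alpha_sup beta01 beta_sup lambda01
  lambda_inf eps_distr R_averaged T_averaged y_def x_def cond_aP cond_bP sum_a sum_b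
  eps_indep p_gt0 (FP z Fz).
have residual z n : F z -> Rop n z - z = Rop n z0 - z0.
  move=> Fz.
  exact: (fixed_residual_eq (T_averaged n) (beta01 n) (R_averaged n) (FP _ Fz n) (FP _ Fz0 n)).
split.
- apply: filterS (qf z0 Fz0) => w [_ [hT _]] z Fz.
  apply: (cvg_same_dist hT) => n; rewrite -(residual z n Fz) -normrN; congr `| _ |.
  by rewrite -[Rop n (x n w) - T _ _]opprB -opprD addrA.
- apply: filterS (qf z0 Fz0) => w [_ [_ hR]] z Fz.
  apply: (cvg_same_dist hR) => n.
  rewrite -[z0 - _]opprB -(residual z n Fz) opprB; congr `| _ |.
  by rewrite opprB addrA.
move=> wF.
have [s sd] := hsum_approximable Hsep.
have [t tF Ft] := approximable_subset Fz0 sd.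
pose om := omega eps.
have om0 i : 0 < om i by exact: (omega_gt0 eps_distr p_gt0).
have aeT : {ae P, forall w j, cvgn (fun n => wsq om ((x n w : hsum H) - t j))}.
  by apply: ae_forall_count => j; apply: filterS (qf _ (Ft j)) => w [].
pose Good w := (forall z, F z -> cvgn (fun n => wsq om ((x n w : hsum H) - z))) /\
  exists2 l, F l & weakly_cvg (fun n => x n w : hsum H) l.
have [N [mN N0 GoodN]] : {ae P, forall w, Good w}.
  apply: filterS2 aeT wF => w cT wFw.
  have [B xB] := wsq_bounded om0 (cT 0%N).
  have cF := wsq_cvg_approximable om0 xB tF cT.
  by split=> //; exact: (opial om0 sd xB wFw cF).
have {}GoodN w : ~ N w -> Good w by move/(subsetCl GoodN).
have /choice[f fP] : forall w, exists l, [/\ F l, N w -> l = z0 &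
    ~ N w -> weakly_cvg (fun n => x n w : hsum H) l].
  move=> w; have [Nw|nNw] := pselect (N w); first by exists z0.
  by have [_ [l Fl xl]] := GoodN w nNw; exists l.
have mf : measurable_fun setT (f : Omega -> borel (hsum H)).
  apply: (weak_limit_measurable (N := N) (z := z0) (u := fun n w => x n w : hsum H) sd) => //.
  - by move=> w; have [] := fP w.
  - by move=> w; have [] := fP w.
have aeN (Q : Omega -> Prop) : (forall w, ~ N w -> Q w) -> {ae P, forall w, Q w}.
  move=> NQ; exists N; split => // w /= nQ.
  by apply: contrapT => nNw; apply: nQ; exact: NQ.
exists (mfun_Sub (mem_set mf : (f : Omega -> borel (hsum H)) \in mfun)); split.
- by move=> w; have [] := fP w.
- by apply: aeN => w; have [] := fP w.
- have aex : {ae P, forall w, ~ N w} by exact: aeN.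
  apply: filterS2 aex => w nNw; have [cF _] := GoodN w nNw; have [Ff _ xf] := fP w.
  exact: (weak_to_strong om0 (xf nNw) (cF _ Ff)).
Qed.
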